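(* Let $\varphi$ be an arithmetical formula such that for every subformula of $\varphi$ of the form $A\rightarrow B$, the antecedent $A$ contains no occurrence of $\rightarrow$ and no unbounded existential quantifier (bounded existential quantifiers are allowed, and negations are not counted as implications). Then there is an arithmetical formula $\psi$ (with free variables among those of $\varphi$) such that $\Box\varphi\leftrightarrow\psi$ is constructively valid, i.e. its universal closure is constructively true.
   Context: The language consists of first-order arithmetic ($0,1,+,\cdot,<,=$, connectives $\neg,\wedge,\vee,\rightarrow$, quantifiers $\exists,\forall$ over natural numbers; formulas without $\Box$ are arithmetical) together with a modal operator $\Box$. $A\leftrightarrow B$ abbreviates $(A\rightarrow B)\wedge(B\rightarrow A)$. Witnesses (continuous function realizability) are sets of natural numbers defined by recursion on formulas with free variables assigned natural numbers: a witness for an atomic formula or for $\neg A$ exists iff the formula is true ($\neg A$ is true iff $A$ has no witness) and carries no information; for $A\wedge B$, witnesses for both; for $A\vee B$, a choice of disjunct plus a witness for it; for $\exists x\,A(x)$, a number $n$ and a witness for $A(n)$; for $\forall x\,A(x)$, on input $n$ a witness for $A(n)$; for $A\rightarrow B$, a real $W$ coding a continuous map (output determined by finite initial segments of input) such that for every witness $X$ of $A$ (arbitrary, not necessarily computable), $W_X$ is a witness for $B$; for $\Box A$, a standard code (natural number) of a recursive witness for $A$. A sentence is constructively true iff it has a recursive witness; so $\Box A$ expresses that $A$ is constructively true. *)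

(* Defs.v *)
From mathcomp Require Import all_boot.

Set Implicit Arguments.
Unset Strict Implicit.
Unset Printing Implicit Defensive.

(** * Syntax: variables are named by natural numbers *)

Inductive term : Type :=
| TVar of nat
| TZero
| TOne
| TAdd of term & term
| TMul of term & term.

Inductive form : Type :=
| FEq of term & term
| FLt of term & term
| FNot of form
| FAnd of form & form
| FOr of form & form
| FImp of form & form
| FEx of nat & form
| FAll of nat & form
| FBox of form.

Definition FIff (A B : form) : form := FAnd (FImp A B) (FImp B A).

Fixpoint tfv (t : term) : seq nat :=
  match t with
  | TVar x => [:: x]
  | TZero | TOne => [::]
  | TAdd s u | TMul s u => tfv s ++ tfv u
  end.

Fixpoint fv (A : form) : seq nat :=
  match A with
  | FEq s t | FLt s t => tfv s ++ tfv t
  | FNot B | FBox B => fv B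
  | FAnd B C | FOr B C | FImp B C => fv B ++ fv C
  | FEx x B | FAll x B => [seq y <- fv B | y != x]
  end.

Definition universal_closure (A : form) : form :=
  foldr FAll A (undup (fv A)).

Fixpoint subformula (A B : form) : Prop :=
  A = B \/
  match B with
  | FEq _ _ | FLt _ _ => False
  | FNot C | FBox C | FEx _ C | FAll _ C => subformula A C
  | FAnd C D | FOr C D | FImp C D => subformula A C \/ subformula A D
  end.

Definition arithmetical (A : form) : Prop :=
  forall B, ~ subformula (FBox B) A.

Definition imp_free (A : form) : Prop :=
  forall B C, ~ subformula (FImp B C) A.

(* The quantifier in [FEx x B] is bounded when it reads
   "exists x < t, C", i.e. "exists x, x < t /\ C" with x not in t. *)
Definition bounded_quantifier (x : nat) (B : form) : Prop :=
  exists t C, B = FAnd (FLt (TVar x) t) C /\ x \notin tfv t.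

Definition no_unbounded_ex (A : form) : Prop :=
  forall x B, subformula (FEx x B) A -> bounded_quantifier x B.

(** * Partial recursive functions and their codes *)

(* Cantor's pairing, a bijection from nat * nat to nat. *)
Definition cpair (a b : nat) : nat := ((a + b) * (a + b).+1)./2 + b.

(* Unary mu-recursive functions; several arguments are passed as one number
   through [cpair]. *)
Inductive code : Type :=
| CZero
| CSucc
| CLeft
| CRight
| CPair of code & code
| CComp of code & code
| CPrec of code & code
| CMu of code.

(* [eval c n m]: the computation c on input n halts with output m. *)
Fixpoint eval (c : code) (n m : nat) : Prop :=
  match c with
  | CZero => m = 0
  | CSucc => m = n.+1
  | CLeft => exists b, n = cpair m b
  | CRight => exists a, n = cpair a m
  | CPair c1 c2 =>
      exists a b, [/\ eval c1 n a, eval c2 n b & m = cpair a b]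
  | CComp c1 c2 => exists a, eval c2 n a /\ eval c1 a m
  | CPrec c1 c2 =>
      exists a k, n = cpair a k /\
        (fix iterates (k r : nat) : Prop :=
           match k with
           | 0 => eval c1 a r
           | k'.+1 =>
               exists r', iterates k' r' /\ eval c2 (cpair a (cpair k' r')) r
           end) k m
  | CMu c1 =>
      eval c1 (cpair n m) 0 /\
      forall i, i < m -> exists r, eval c1 (cpair n i) r.+1
  end.

(* A bijective Goedel numbering. *)
Fixpoint encode (c : code) : nat :=
  match c with
  | CZero => 0
  | CSucc => 1
  | CLeft => 2
  | CRight => 3
  | CPair c1 c2 => 4 * cpair (encode c1) (encode c2) + 4
  | CComp c1 c2 => 4 * cpair (encode c1) (encode c2) + 5
  | CPrec c1 c2 => 4 * cpair (encode c1) (encode c2) + 6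
  | CMu c1 => 4 * encode c1 + 7
  end.

(** * Reals *)

(* Sets of natural numbers, as characteristic functions (arbitrary, not
   necessarily computable). *)
Definition real : Type := nat -> bool.

Definition computes (c : code) (X : real) : Prop :=
  forall n, eval c n (X n : nat).

Definition recursive (X : real) : Prop := exists c, computes c X.

Definition evens (X : real) : real := fun k => X k.*2.
Definition odds (X : real) : real := fun k => X k.*2.+1.
Definition column (X : real) (n : nat) : real := fun k => X (cpair n k).

(* The initial segment of X of length k, given by k and the canonical index of
   X restricted to {0, ..., k - 1}. *)
Definition segment (X : real) (k : nat) : nat :=
  cpair k (\sum_(i < k) X i * 2 ^ i).

(* [app W X Y]: W_X is defined and equals Y. The set W consists of codes of
   triples (s, n, b), meaning that the output has value b at n as soon as s is
   an initial segment of the input. *)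
Definition app (W X Y : real) : Prop :=
  forall (n : nat) (b : bool),
    Y n = b <-> exists k, W (cpair (segment X k) (cpair n b)).

(** * Witnesses *)

Fixpoint tval (v : nat -> nat) (t : term) : nat :=
  match t with
  | TVar x => v x
  | TZero => 0
  | TOne => 1
  | TAdd s u => tval v s + tval v u
  | TMul s u => tval v s * tval v u
  end.

Definition upd (v : nat -> nat) (x n : nat) : nat -> nat :=
  fun y => if y == x then n else v y.

(* [witness v A X]: X is a witness for A under the assignment v. A witness
   carrying no information is the empty set; a number n is given as {n}, and a
   number n together with a witness Y as the join of {n} and Y. *)
Fixpoint witness (v : nat -> nat) (A : form) (X : real) : Prop :=
  match A with
  | FEq s t => tval v s = tval v t /\ X =1 pred0
  | FLt s t => tval v s < tval v t /\ X =1 pred0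
  | FNot B => (~ exists Y, witness v B Y) /\ X =1 pred0
  | FAnd B C => witness v B (evens X) /\ witness v C (odds X)
  | FOr B C =>
      (evens X =1 pred1 0 /\ witness v B (odds X)) \/
      (evens X =1 pred1 1 /\ witness v C (odds X))
  | FImp B C =>
      forall Y, witness v B Y -> exists Z, app X Y Z /\ witness v C Z
  | FEx x B => exists n, evens X =1 pred1 n /\ witness (upd v x n) B (odds X)
  | FAll x B => forall n, witness (upd v x n) B (column X n)
  | FBox B =>
      exists c Y, [/\ X =1 pred1 (encode c), computes c Y & witness v B Y]
  end.

(* For sentences; the assignment is then irrelevant. *)
Definition constructively_true (A : form) : Prop :=
  exists X, recursive X /\ witness (fun _ => 0) A X.

Definition constructively_valid (A : form) : Prop :=
  constructively_true (universal_closure A).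

(* Main.v *)
(* A witness of [psi] should be a code of a recursive witness of [phi] and
   nothing more, so [psi] is taken to be "exists z, not not theta(z)", where
   [theta] defines arithmetically the set of codes of recursive witnesses of
   [phi]. A double negation carries no information, and a box-free formula has
   some witness iff it is classically true, since a constant map realizes an
   implication with a realized conclusion; hence classical definability of that
   set suffices.

   The obstacle is the quantifier over all reals in the clause for [A -> B].
   If [A] has no implication and no unbounded existential quantifier, its
   witnesses form an arithmetically closed subset of Cantor space, every choice
   made by such a witness being bounded. By compactness, "every [X] in a closed
   set has a finite initial segment with the arithmetical property w" is
   arithmetical. By induction on [B], so is "the continuous functional with
   graph [G] sends every point of the closed set to a witness of [B]": nested
   implications pass to a product of closed sets, disjunctions and existential
   quantifiers in [B] to relatively clopen pieces. *)

From mathcomp Require Import all_boot zify.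
From mathcomp Require Import boolp.
From Stdlib Require Cantor.
Require Import Defs.

Set Implicit Arguments.
Unset Strict Implicit.
Unset Printing Implicit Defensive.

(** * Pairing of numbers, joins and columns of reals *)

(** A product of consecutive numbers is even, so the halving is exact; the inverse of
    [Cantor.to_nat] then supplies projections for [cpair]. *)
Lemma cpairE a b : cpair a b = Cantor.to_nat (a, b).
Proof.
have H := Cantor.to_nat_spec a b.
have E : ((a + b) * (a + b).+1)./2.*2 = (a + b) * (a + b).+1.
  by rewrite -[RHS]odd_double_half oddM /= andbN.
rewrite /cpair; move: E; rewrite -muln2; nia.
Qed.

Definition pfst (n : nat) : nat := (Cantor.of_nat n).1.
Definition psnd (n : nat) : nat := (Cantor.of_nat n).2.

Lemma pfstK a b : pfst (cpair a b) = a.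
Proof. by rewrite /pfst cpairE Cantor.cancel_of_to. Qed.

Lemma psndK a b : psnd (cpair a b) = b.
Proof. by rewrite /psnd cpairE Cantor.cancel_of_to. Qed.

Lemma cpairK n : cpair (pfst n) (psnd n) = n.
Proof. by rewrite cpairE -surjective_pairing Cantor.cancel_to_of. Qed.

Lemma cpair_inj a b c d : cpair a b = cpair c d -> a = c /\ b = d.
Proof. by move=> H; rewrite -(pfstK a b) -{2}(psndK a b) H pfstK psndK. Qed.

(** Division-free form: it feeds [nia], and it makes the graph of [cpair] a polynomial equation. *)
Lemma double_cpair a b : 2 * cpair a b = (a + b) * (a + b).+1 + 2 * b.
Proof. have H := Cantor.to_nat_spec a b; rewrite cpairE; nia. Qed.

Lemma cpair_ge a b : a <= cpair a b /\ b <= cpair a b.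
Proof. have H := double_cpair a b; nia. Qed.

Arguments cpair : simpl never.

Definition join (X Y : real) : real :=
  fun n => if odd n then Y n./2 else X n./2.

Lemma evens_join X Y : evens (join X Y) = X.
Proof. by apply: funext => n; rewrite /evens /join odd_double doubleK. Qed.

Lemma odds_join X Y : odds (join X Y) = Y.
Proof.
by apply: funext => n; rewrite /odds /join /= odd_double /= uphalf_double.
Qed.

Lemma join_evens_odds X : join (evens X) (odds X) = X.
Proof.
apply: funext => n; rewrite /join /evens /odds -[in RHS](odd_double_half n).
by case: (odd n).
Qed.

Definition columns (F : nat -> real) : real := fun p => F (pfst p) (psnd p).

Lemma column_columns F n : column (columns F) n = F n.
Proof. by apply: funext => k; rewrite /column /columns pfstK psndK. Qed.

Lemma eq_real_nat (X : real) n (b : bool) : X n = b <-> (X n : nat) = b :> nat.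
Proof. by split=> [->//|]; case: (X n) b => [] []. Qed.

(** * Binary expansions *)

Definition bit (s i : nat) : bool := odd (s %/ 2 ^ i).

Definition bits (X : real) (k : nat) : nat := \sum_(i < k) X i * 2 ^ i.

Lemma bitsS X k : bits X k.+1 = bits X k + X k * 2 ^ k.
Proof. by rewrite /bits big_ord_recr. Qed.

Lemma bits_lt X k : bits X k < 2 ^ k.
Proof.
elim: k => [|k IH]; first by rewrite /bits big_ord0.
by rewrite bitsS expnS; case: (X k); lia.
Qed.

Lemma bit_bits X k i : i < k -> bit (bits X k) i = X i.
Proof.
elim: k => // k IH; rewrite ltnS leq_eqVlt bitsS => /orP[/eqP->|lt_ik].
  rewrite /bit divnDMl ?expn_gt0 // divn_small ?bits_lt //.
  by case: (X k).
(* As [i < k], the new summand is an even multiple of [2 ^ i], so it does not change the parity of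
   the quotient. *)
rewrite -IH // /bit; have -> : 2 ^ k = 2 ^ (k - i.+1) * 2 * 2 ^ i.
  by rewrite -expnSr -expnD; congr (2 ^ _); lia.
rewrite mulnA divnDMl ?expn_gt0 // oddD mulnA oddM andbF; exact: addbF.
Qed.

Lemma eq_bits X Y k : (forall i, i < k -> X i = Y i) -> bits X k = bits Y k.
Proof. by move=> H; apply: eq_bigr => i _; rewrite H. Qed.

Lemma bits_bit s k : s < 2 ^ k -> bits (bit s) k = s.
Proof.
elim: k s => [|k IH] s lt_s; first by rewrite /bits big_ord0; case: s lt_s.
have lt_r : s %% 2 ^ k < 2 ^ k by rewrite ltn_pmod ?expn_gt0.
have lt_q : s %/ 2 ^ k < 2 by rewrite ltn_divLR ?expn_gt0 // -expnS.
have Er : bits (bit s) k = s %% 2 ^ k.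
  rewrite -[RHS]IH //; apply: eq_bits => i lt_ik.
  rewrite /bit [in LHS](divn_eq s (2 ^ k)).
  have -> : s %/ 2 ^ k * 2 ^ k = s %/ 2 ^ k * 2 ^ (k - i.+1) * 2 * 2 ^ i.
    by rewrite -!mulnA -expnS -expnD; congr (_ * 2 ^ _); lia.
  by rewrite divnMDl ?expn_gt0 // oddD oddM andbF.
rewrite bitsS Er [RHS](divn_eq s (2 ^ k)) addnC; congr (_ * _ + _).
by rewrite /bit; case: (s %/ 2 ^ k) lt_q => [|[|]].
Qed.

Lemma segmentE X k : segment X k = cpair k (bits X k). Proof. by []. Qed.

Lemma eq_segment X Y k :
  (forall i, i < k -> X i = Y i) -> segment X k = segment Y k.
Proof. by move=> H; rewrite !segmentE (eq_bits H). Qed.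

(** Splits the condition into an arithmetical bound and finitely many bit queries, the form in which
    it is later shown to be clopen. *)
Lemma segmentP X k s :
  cpair k s = segment X k <-> s < 2 ^ k /\ forall i, i < k -> X i = bit s i.
Proof.
rewrite segmentE; split=> [/cpair_inj[_ ->]|[lt_s H]].
  by split=> [|i lt_ik]; [exact: bits_lt | rewrite bit_bits].
by rewrite (eq_bits H) bits_bit.
Qed.

(** * Computable functions *)

Definition computable (f : nat -> nat) : Prop :=
  exists c, forall n, eval c n (f n).

Lemma computable_comp f g :
  computable f -> computable g -> computable (fun n => f (g n)).
Proof. by move=> [c Hc] [d Hd]; exists (CComp c d) => n /=; exists (g n). Qed.

Lemma computable_pair f g :
  computable f -> computable g -> computable (fun n => cpair (f n) (g n)).
Proof.
by move=> [c Hc] [d Hd]; exists (CPair c d) => n /=; exists (f n), (g n).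
Qed.

Lemma computable_pfst : computable pfst.
Proof. by exists CLeft => n /=; exists (psnd n); rewrite cpairK. Qed.

Lemma computable_psnd : computable psnd.
Proof. by exists CRight => n /=; exists (pfst n); rewrite cpairK. Qed.

(** There is no identity code; pairing the two projections restores the input. *)
Lemma computable_id : computable id.
Proof.
have [c Hc] := computable_pair computable_pfst computable_psnd.
by exists c => n; have := Hc n; rewrite cpairK.
Qed.

Lemma computable_succ : computable succn.
Proof. by exists CSucc. Qed.

Lemma computable_const m : computable (fun=> m).
Proof.
elim: m => [|m IH]; first by exists CZero.
exact: computable_comp computable_succ IH.
Qed.

Definition computable2 (h : nat -> nat -> nat) : Prop :=
  computable (fun p => h (pfst p) (psnd p)).

Lemma computable_comp2 h f g :
  computable2 h -> computable f -> computable g ->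
  computable (fun n => h (f n) (g n)).
Proof.
move=> Hh Hf Hg; have [c Hc] := computable_comp Hh (computable_pair Hf Hg).
by exists c => n; have := Hc n; rewrite pfstK psndK.
Qed.

(** All primitive recursions below use this schema: in the argument [p] of [g], [psnd (psnd p)] is
    the previous value and [pfst (psnd p)] the counter. *)
Lemma computable2_prec f g h :
  computable f -> computable g ->
  (forall a, h a 0 = f a) ->
  (forall a k, h a k.+1 = g (cpair a (cpair k (h a k)))) ->
  computable2 h.
Proof.
move=> [c Hc] [d Hd] h0 hS; exists (CPrec c d) => n /=.
exists (pfst n), (psnd n); split; first by rewrite cpairK.
elim: (psnd n) => [|k IH]; first by rewrite h0.
by exists (h (pfst n) k); split => //; rewrite hS.
Qed.

Lemma computable2_add : computable2 addn.
Proof.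
apply: (computable2_prec (f := id) (g := fun p => (psnd (psnd p)).+1)).
- exact: computable_id.
- apply: computable_comp computable_succ _.
  exact: computable_comp computable_psnd computable_psnd.
- exact: addn0.
- by move=> a k; rewrite !psndK addnS.
Qed.

Lemma computable2_mul : computable2 muln.
Proof.
apply: (computable2_prec (f := fun=> 0)
          (g := fun p => psnd (psnd p) + pfst p)).
- exact: computable_const.
- apply: computable_comp2 computable2_add _ computable_pfst.
  exact: computable_comp computable_psnd computable_psnd.
- exact: muln0.
- by move=> a k; rewrite !psndK pfstK mulnSr.
Qed.

Lemma computable_exp2 : computable (expn 2).
Proof.
(* [CPrec] always carries a parameter, so a unary recursion runs with a dummy one and is then
   restricted to the diagonal. *)
have H : computable2 (fun a k => 2 ^ k).
  apply: (computable2_prec (f := fun=> 1) (g := fun p => 2 * psnd (psnd p))).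
  - exact: computable_const.
  - apply: computable_comp2 computable2_mul (computable_const 2) _.
    exact: computable_comp computable_psnd computable_psnd.
  - by [].
  - by move=> a k; rewrite !psndK expnS.
exact: computable_comp2 H computable_id computable_id.
Qed.

Lemma computable_pred : computable predn.
Proof.
have H : computable2 (fun a k => k.-1).
  apply: (computable2_prec (f := fun=> 0) (g := fun p => pfst (psnd p))).
  - exact: computable_const.
  - exact: computable_comp computable_pfst computable_psnd.
  - by [].
  - by move=> a k; rewrite !psndK pfstK.
exact: computable_comp2 H computable_id computable_id.
Qed.

Lemma computable2_sub : computable2 subn.
Proof.
apply: (computable2_prec (f := id) (g := fun p => (psnd (psnd p)).-1)).
- exact: computable_id.
- apply: computable_comp computable_pred _.
  exact: computable_comp computable_psnd computable_psnd.
- exact: subn0.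
- by move=> a k; rewrite !psndK subnS.
Qed.

Lemma computable_eqn f g :
  computable f -> computable g -> computable (fun n => f n == g n : nat).
Proof.
move=> Hf Hg.
(* With truncated subtraction, [1] minus the distance is the equality test. *)
have -> : (fun n => f n == g n : nat) =
          (fun n => 1 - ((f n - g n) + (g n - f n))).
  by apply: funext => n; case: eqP; lia.
apply: computable_comp2 computable2_sub (computable_const 1) _.
by apply: computable_comp2 computable2_add _ _;
  apply: computable_comp2 computable2_sub _ _.
Qed.

(** * Recursive realizers for the two directions of the equivalence *)

(* [p] is read as a triple [(s, n, b)] with [s] coding a segment
   [(k, sigma)]; the functional outputs at [n] the bit [F sigma = G n] as soon
   as the segment has length [L n]. *)
Definition test_map (L F G : nat -> nat) : real := fun p =>
  (pfst (pfst p) == L (pfst (psnd p))) &&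
  (psnd (psnd p) == (F (psnd (pfst p)) == G (pfst (psnd p)))).

Lemma test_map_recursive L F G :
  computable L -> computable F -> computable G -> recursive (test_map L F G).
Proof.
move=> HL HF HG; suff [c Hc] : computable (fun p => test_map L F G p : nat).
  by exists c.
pose lr := computable_comp computable_pfst computable_psnd.
pose rl := computable_comp computable_psnd computable_pfst.
pose rr := computable_comp computable_psnd computable_psnd.
pose ll := computable_comp computable_pfst computable_pfst.
have -> : (fun p => test_map L F G p : nat) = (fun p =>
    (pfst (pfst p) == L (pfst (psnd p)) : nat) *
    (psnd (psnd p) == (F (psnd (pfst p)) == G (pfst (psnd p))) : nat)).
  by apply: funext => p; rewrite mulnb.
apply: computable_comp2 computable2_mul _ _.
  exact: computable_eqn ll (computable_comp HL lr).
apply: computable_eqn rr _.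
exact: computable_eqn (computable_comp HF rl) (computable_comp HG lr).
Qed.

(** For output position [n] only the segment of length [L n] triggers an answer, so exactly one bit
    is enumerated there. *)
Lemma test_map_app L F G X Y :
  (forall n, Y n = (F (bits X (L n)) == G n)) -> app (test_map L F G) X Y.
Proof.
move=> H n b; rewrite H /test_map; split=> [<-|[k]].
  by exists (L n); rewrite segmentE !(pfstK, psndK) !eqxx.
rewrite segmentE !(pfstK, psndK) => /andP[/eqP-> /eqP].
by case: eqP; case: b.
Qed.

Lemma bits_pred1 e k : bits (pred1 e) k = (e < k) * 2 ^ e.
Proof.
elim: k => [|k IH]; first by rewrite /bits big_ord0.
rewrite bitsS IH /=; case: (ltngtP k e) => [lt|lt|->] /=.
- have -> : (e < k.+1) = false by lia.
  by rewrite mul0n addn0.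
- have -> : (e < k.+1) by lia.
  by rewrite mul0n addn0.
- by rewrite ltnS leqnn.
Qed.

Lemma bits_join_pred1 e k :
  bits (join (pred1 e) pred0) k = (e.*2 < k) * 2 ^ e.*2.
Proof.
rewrite -bits_pred1; apply: eq_bits => i _; rewrite /join /=.
by case: ifP => Hi; lia.
Qed.

(* On input [pred1 e], [sigma] is [2 ^ e] or [0], so [sigma ^ 2 = 2 ^ n] holds
   iff [n = 2 e]. *)
Definition add_blank : real := test_map succn (fun s => s * s) (expn 2).
Definition drop_blank : real :=
  test_map (fun n => (n + n).+1) id (fun n => 2 ^ (n + n)).

Lemma add_blank_recursive : recursive add_blank.
Proof.
apply: test_map_recursive computable_succ _ computable_exp2.
exact: computable_comp2 computable2_mul computable_id computable_id.
Qed.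

Lemma drop_blank_recursive : recursive drop_blank.
Proof.
have H := computable_comp2 computable2_add computable_id computable_id.
apply: test_map_recursive computable_id _.
  exact: computable_comp computable_succ H.
exact: computable_comp computable_exp2 H.
Qed.

(** A witness of [FBox phi] is [pred1 e]; one of [psi] is the same number joined with the blank
    witness of a negation. [add_blank] and [drop_blank] translate between the two. *)
Lemma add_blank_app e : app add_blank (pred1 e) (join (pred1 e) pred0).
Proof.
apply: test_map_app => n; rewrite bits_pred1 ltnS /join /=.
(* The segment of length [n + 1] misses [e] only if [n < e], and then [n] is not [2e]. *)
case: leqP => [le_en|lt_ne]; last first.
  rewrite !mul0n [RHS]eq_sym expn_eq0 /=; case: ifP => // Hn.
  by apply/eqP => E; move: lt_ne; rewrite -E; lia.
rewrite mul1n -expnD eqn_exp2l // addnn; case: ifP => Hn.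
  by lia.
by lia.
Qed.

Lemma drop_blank_app e : app drop_blank (join (pred1 e) pred0) (pred1 e).
Proof.
apply: test_map_app => n; rewrite bits_join_pred1 /=.
case: ltnP => le_en.
  by rewrite mul1n eqn_exp2l // addnn eq_sym -!muln2 eqn_pmul2r.
rewrite mul0n [RHS]eq_sym expn_eq0 /=; apply/eqP => E; lia.
Qed.

Lemma recursive_join X Y : recursive X -> recursive Y -> recursive (join X Y).
Proof.
move=> [c Hc] [d Hd].
have HX : computable (fun n => X n : nat) by exists c.
have HY : computable (fun n => Y n : nat) by exists d.
have Hodd : computable (fun n => odd n : nat).
  have H : computable2 (fun a k => odd k : nat).
    apply: (computable2_prec (f := fun=> 0)
              (g := fun p => 1 - psnd (psnd p))).
    - exact: computable_const.
    - apply: computable_comp2 computable2_sub (computable_const 1) _.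
      exact: computable_comp computable_psnd computable_psnd.
    - by [].
    - by move=> a k; rewrite !psndK /=; case: odd.
  exact: computable_comp2 H computable_id computable_id.
have Hhalf : computable half.
  have H : computable2 (fun a k => k./2).
    apply: (computable2_prec (f := fun=> 0)
              (g := fun p => psnd (psnd p) + odd (pfst (psnd p)))).
    - exact: computable_const.
    - apply: computable_comp2 computable2_add _ _.
        exact: computable_comp computable_psnd computable_psnd.
      apply: computable_comp Hodd _.
      exact: computable_comp computable_pfst computable_psnd.
    - by [].
    - by move=> a k; rewrite !psndK pfstK /= uphalf_half addnC.
  exact: computable_comp2 H computable_id computable_id.
have [f Hf] : computable (fun n => join X Y n : nat).
  have -> : (fun n => join X Y n : nat) =
      (fun n => odd n * Y n./2 + (1 - odd n) * X n./2).
    by apply: funext => n; rewrite /join; case: odd; rewrite !(mul0n, mul1n, addn0).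
  apply: computable_comp2 computable2_add _ _.
    exact: computable_comp2 computable2_mul Hodd (computable_comp HY Hhalf).
  apply: computable_comp2 computable2_mul _ (computable_comp HX Hhalf).
  exact: computable_comp2 computable2_sub (computable_const 1) Hodd.
by exists f.
Qed.

Lemma recursive_columns X : recursive X -> recursive (columns (fun=> X)).
Proof.
move=> [c Hc].
have HX : computable (fun n => X n : nat) by exists c.
by have [d Hd] := computable_comp HX computable_psnd; exists d.
Qed.

(** * Determinism and Goedel numbering *)

(** For [CMu], two distinct results are impossible: the smaller is a zero, while the larger demands
    a successor there. *)
Lemma eval_inj c n m m' : eval c n m -> eval c n m' -> m = m'.
Proof.
elim: c n m m' => [||||c IHc d IHd|c IHc d IHd|c IHc d IHd|c IHc] n m m' /=.
- by move=> -> ->.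
- by move=> -> ->.
- by move=> [b ->] [b' /cpair_inj[]].
- by move=> [b ->] [b' /cpair_inj[]].
- move=> [a [b [Ha Hb ->]]] [a' [b' [Ha' Hb' ->]]].
  by rewrite (IHc _ _ _ Ha Ha') (IHd _ _ _ Hb Hb').
- move=> [a [Ha Hm]] [a' [Ha' Hm']].
  by move: Hm; rewrite (IHd _ _ _ Ha Ha') => /IHc; apply.
- move=> [a [k [-> H]]] [a' [k' [/cpair_inj[<- <-] H']]].
  elim: k m m' H H' => [|k IHk] m m'; first exact: IHc.
  move=> [r [Hr Hm]] [r' [/(IHk _ _ Hr)<- Hm']]; exact: IHd Hm Hm'.
- move=> [H0 Hlt] [H0' Hlt'].
  case: (ltngtP m m') => // lt_mm.
    by have [r /(IHc _ _ _ H0)] := Hlt' _ lt_mm.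
  by have [r /(IHc _ _ _ H0')] := Hlt _ lt_mm.
Qed.

(** Atomic codes lie below [4]; for compound ones the residue modulo [4] reveals the constructor. *)
Lemma encode_inj : injective encode.
Proof.
have pairE a b c d k : 4 * cpair a b + k = 4 * cpair c d + k -> a = c /\ b = d.
  by move=> E; apply: cpair_inj; lia.
elim=> [||||c IHc d IHd|c IHc d IHd|c IHc d IHd|c IHc]
  [||||c' d'|c' d'|c' d'|c'] //=; try lia.
- by move=> /pairE[/IHc-> /IHd->].
- by move=> /pairE[/IHc-> /IHd->].
- by move=> /pairE[/IHc-> /IHd->].
- by move=> E; congr CMu; apply: IHc; lia.
Qed.

(** Every number is a code, so arithmetic can quantify over numbers in place of codes. Components
    are smaller than the code, whence the strong induction. *)
Lemma encode_surj e : exists c, encode c = e.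
Proof.
elim/ltn_ind: e => e IH.
case: (ltnP e 4) => [|le4].
  by case: e {IH} => [|[|[|[|]]]] // _;
    [exists CZero | exists CSucc | exists CLeft | exists CRight].
have [q [r [lt_r Ee]]] : exists q r, r < 4 /\ e = 4 * q + 4 + r.
  exists ((e - 4) %/ 4), ((e - 4) %% 4); rewrite ltn_pmod //.
  by split=> //; have := divn_eq (e - 4) 4; lia.
have [leA leB] := cpair_ge (pfst q) (psnd q); rewrite cpairK in leA leB.
have [c1 E1] : exists c, encode c = pfst q by apply: IH; lia.
have [c2 E2] : exists c, encode c = psnd q by apply: IH; lia.
have [c3 E3] : exists c, encode c = q by apply: IH; lia.
case: r lt_r Ee => [|[|[|[|]]]] // _ ->;
  [exists (CPair c1 c2) | exists (CComp c1 c2) | exists (CPrec c1 c2)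
  | exists (CMu c3)]; rewrite /= ?E1 ?E2 ?E3 ?cpairK; lia.
Qed.

(** * Arithmetically definable predicates *)

Notation env := (nat -> nat).

Definition scons (n : nat) (v : env) : env :=
  fun i => if i is i'.+1 then v i' else n.

Notation "n .: v" := (scons n v) (at level 60, right associativity).

Definition shift (v : env) : env := fun i => v i.+1.

(* De Bruijn convention: a quantifier binds position [0]. *)
Inductive def : (env -> Prop) -> Prop :=
| def_teq s t : def (fun v => tval v s = tval v t)
| def_and P Q : def P -> def Q -> def (fun v => P v /\ Q v)
| def_not P : def P -> def (fun v => ~ P v)
| def_scons P : def P -> def (fun v => exists n, P (n .: v)).

(** Definability of the graph, with the value at position [0] and the arguments shifted past it. *)
Definition defn (f : env -> nat) : Prop := def (fun v => v 0 = f (shift v)).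

Lemma def_ext P Q : (forall v, P v <-> Q v) -> def P -> def Q.
Proof. by move=> H; have -> : P = Q by apply: funext => v; apply: propext. Qed.

Lemma def_ex (Q : nat -> env -> Prop) :
  def (fun v => Q (v 0) (shift v)) -> def (fun v => exists n, Q n v).
Proof. by move=> H; exact: def_scons H. Qed.

Lemma def_all (Q : nat -> env -> Prop) :
  def (fun v => Q (v 0) (shift v)) -> def (fun v => forall n, Q n v).
Proof.
move=> H; apply: (@def_ext (fun v => ~ exists n, ~ Q n v)) => [v|].
  by rewrite -forallNE; split=> Hn n; have := Hn n; rewrite not_notE.
exact/def_not/def_ex/def_not.
Qed.

Lemma def_or P Q : def P -> def Q -> def (fun v => P v \/ Q v).
Proof.
move=> HP HQ; apply: (@def_ext (fun v => ~ (~ P v /\ ~ Q v))) => [v|].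
  by rewrite not_andE !not_notE.
by apply: def_not; apply: def_and; apply: def_not.
Qed.

Lemma def_imp P Q : def P -> def Q -> def (fun v => P v -> Q v).
Proof.
move=> HP HQ; apply: (@def_ext (fun v => ~ P v \/ Q v)) => [v|].
  by rewrite implyE.
by apply: def_or => //; apply: def_not.
Qed.

Fixpoint tren (r : nat -> nat) (t : term) : term :=
  match t with
  | TVar x => TVar (r x)
  | TZero => TZero
  | TOne => TOne
  | TAdd s u => TAdd (tren r s) (tren r u)
  | TMul s u => TMul (tren r s) (tren r u)
  end.

Lemma tval_tren r t v : tval v (tren r t) = tval (v \o r) t.
Proof. by elim: t => //= s -> u ->. Qed.

Lemma def_ren P : def P -> forall r, def (fun v => P (v \o r)).
Proof.
elim=> {P} [s t|P Q _ IHP _ IHQ|P _ IH|P _ IH] r.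
- have := def_teq (tren r s) (tren r t).
  by apply: def_ext => v; rewrite !tval_tren.
- exact: def_and.
- exact: def_not.
- apply: def_ex; have := IH (fun i => if i is i'.+1 then (r i').+1 else 0).
  by apply: def_ext => v; split; congr P; apply: funext => -[].
Qed.

Lemma def_shift P : def P -> def (fun v => P (shift v)).
Proof. by move=> HP; exact: def_ren HP succn. Qed.

Lemma defn_shift f : defn f -> defn (fun v => f (shift v)).
Proof.
move=> Hf; have := def_ren Hf (fun i => if i is i'.+1 then i'.+2 else 0).
by apply: def_ext => v.
Qed.

Lemma def_eqn f g : defn f -> defn g -> def (fun v => f v = g v).
Proof.
move=> Hf Hg.
have : def (fun v => exists n, n = f v /\ n = g v).
  by apply: def_ex; apply: def_and.
by apply: def_ext => v; split=> [[n [<- <-]]//|E]; exists (f v).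
Qed.

Lemma defn_tval t : defn (fun v => tval v t).
Proof.
have := def_teq (TVar 0) (tren succn t).
by apply: def_ext => v; rewrite tval_tren.
Qed.

Lemma defn_var i : defn (fun v => v i).
Proof. exact: defn_tval (TVar i). Qed.

(** Terms express only polynomials, so a definable function is substituted through its graph. *)
Lemma def_inst (Q : nat -> env -> Prop) f :
  defn f -> def (fun v => Q (v 0) (shift v)) -> def (fun v => Q (f v) v).
Proof.
move=> Hf HQ; have : def (fun v => exists n, n = f v /\ Q n v).
  by apply: def_ex; apply: def_and.
by apply: def_ext => v; split=> [[n [->]]//|E]; exists (f v).
Qed.

Lemma defn_term2 (op : nat -> nat -> nat) :
  def (fun v => v 0 = op (v 1) (v 2)) ->
  forall f g, defn f -> defn g -> defn (fun v => op (f v) (g v)).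
Proof.
move=> H f g Hf Hg; rewrite /defn.
apply: (@def_inst (fun a v => v 0 = op a (g (shift v))) (fun v => f (shift v))).
  exact: defn_shift.
apply: (@def_inst (fun b v => v 1 = op (v 0) b) (fun v => g (shift (shift v)))).
  exact: defn_shift (defn_shift Hg).
(* The instantiations leave the result at position [2] and the arguments at [1] and [0]; [2 - i]
   reverses this order. *)
by have := def_ren H (fun i => 2 - i).
Qed.

Lemma defn_add f g : defn f -> defn g -> defn (fun v => f v + g v).
Proof.
by apply: (defn_term2 (op := addn)); exact: def_teq (TVar 0) (TAdd (TVar 1) (TVar 2)).
Qed.

Lemma defn_mul f g : defn f -> defn g -> defn (fun v => f v * g v).
Proof.
by apply: (defn_term2 (op := muln)); exact: def_teq (TVar 0) (TMul (TVar 1) (TVar 2)).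
Qed.

Lemma defn_const n : defn (fun=> n).
Proof.
elim: n => [|n IH]; first exact: defn_tval TZero.
by have := defn_add IH (defn_tval TOne); rewrite /= addn1.
Qed.

Lemma defn_succ f : defn f -> defn (fun v => (f v).+1).
Proof.
move=> Hf; have := defn_add Hf (defn_const 1).
by apply: def_ext => v; rewrite addn1.
Qed.

Lemma def_leq f g : defn f -> defn g -> def (fun v => f v <= g v).
Proof.
move=> Hf Hg; have : def (fun v => exists d, g v = f v + d).
  apply: def_ex; apply: def_eqn; first exact: defn_shift.
  by apply: defn_add; [exact: defn_shift | exact: defn_var].
apply: def_ext => v; split=> [[d ->]|le]; first exact: leq_addr.
by exists (g v - f v); rewrite subnKC.
Qed.

Lemma defn_cpair f g : defn f -> defn g -> defn (fun v => cpair (f v) (g v)).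
Proof.
apply: (defn_term2 (op := cpair)).
have : def (fun v => 2 * v 0 = (v 1 + v 2) * (v 1 + v 2).+1 + 2 * v 2).
  by apply: def_eqn; repeat first [exact: defn_var | exact: defn_const
    | apply: defn_add | apply: defn_mul | apply: defn_succ].
by apply: def_ext => v; rewrite -double_cpair; lia.
Qed.

Lemma defn_tsubst t (s : nat -> env -> nat) :
  (forall i, defn (s i)) -> defn (fun v => tval (s^~ v) t).
Proof.
move=> Hs; elim: t => /= [x||| t Ht u Hu|t Ht u Hu].
- exact: Hs.
- exact: defn_const.
- exact: defn_const.
- exact: defn_add.
- exact: defn_mul.
Qed.

Definition up (s : nat -> env -> nat) : nat -> env -> nat :=
  fun i v => if i is i'.+1 then s i' (shift v) else v 0.

Lemma defn_up s : (forall i, defn (s i)) -> forall i, defn (up s i).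
Proof. by move=> Hs [|i]; [exact: defn_var | exact: defn_shift]. Qed.

Lemma up_scons s n v : (up s)^~ (n .: v) = n .: s^~ v.
Proof. by apply: funext => -[]. Qed.

(** Extends [def_ren] from variables to definable functions, so that a relation need be defined only
    at fixed positions. *)
Lemma def_subst P : def P -> forall s : nat -> env -> nat,
  (forall i, defn (s i)) -> def (fun v => P (s^~ v)).
Proof.
elim=> {P} [t u|P Q _ IHP _ IHQ|P _ IH|P _ IH] s Hs.
- by apply: def_eqn; exact: defn_tsubst.
- by apply: def_and; auto.
- by apply: def_not; auto.
- have := def_scons (IH _ (defn_up Hs)).
  by apply: def_ext => v; split=> -[n Hn]; exists n; rewrite up_scons in Hn *.
Qed.

Lemma defn_subst f : defn f -> forall s : nat -> env -> nat,
  (forall i, defn (s i)) -> defn (fun v => f (s^~ v)).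
Proof. by move=> Hf s Hs; have := def_subst Hf (defn_up Hs). Qed.

Lemma def_rel2 (R : nat -> nat -> Prop) f g :
  def (fun v => R (v 0) (v 1)) -> defn f -> defn g ->
  def (fun v => R (f v) (g v)).
Proof.
move=> HR Hf Hg.
by apply: (def_subst HR (s := fun i => nth g [:: f] i)) => -[|[|]].
Qed.

Lemma def_rel3 (R : nat -> nat -> nat -> Prop) f g h :
  def (fun v => R (v 0) (v 1) (v 2)) -> defn f -> defn g -> defn h ->
  def (fun v => R (f v) (g v) (h v)).
Proof.
move=> HR Hf Hg Hh.
by apply: (def_subst HR (s := fun i => nth h [:: f; g] i)) => -[|[|[|]]].
Qed.

Lemma def_consrel (w : env -> Prop) f (g : env -> env) :
  def w -> defn f -> (forall i, defn (fun v => g v i)) ->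
  def (fun v => w (f v .: g v)).
Proof.
move=> Hw Hf Hg.
have := def_subst Hw (s := fun i v => (f v .: g v) i).
by apply => -[].
Qed.

Lemma def_dvdn f g : defn f -> defn g -> def (fun v => f v %| g v).
Proof.
apply: (@def_rel2 (fun a b => a %| b)).
have : def (fun v => exists q, v 1 = q * v 0) 
  by apply: def_ex; apply: def_eqn; last apply: defn_mul; exact: defn_var.
by apply: def_ext => v; split=> /dvdnP.
Qed.

Ltac def_step :=
  lazymatch goal with
  | |- defn (fun v => v _) => exact: defn_var
  | |- defn (fun v => _ + _) => apply: defn_add
  | |- defn (fun v => _ * _) => apply: defn_mul
  | |- defn (fun v => cpair _ _) => apply: defn_cpair
  | |- defn (fun v => _.+1) => apply: defn_succ
  | |- defn _ => exact: defn_const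
  | |- def (fun v => _ /\ _) => apply: def_and
  | |- def (fun v => _ \/ _) => apply: def_or
  | |- def (fun v => ~ _) => apply: def_not
  | |- def (fun v => exists n, _) => apply: def_ex
  | |- def (fun v => _ = _ :> nat) => apply: def_eqn
  | |- def (fun v => is_true (_ <= _)) => apply: def_leq
  | |- def (fun v => is_true (_ %| _)) => apply: def_dvdn
  | |- def (fun v => forall n : nat, _) => apply: def_all
  | |- def (fun v => _ -> _) => apply: def_imp
  end.

Ltac def_auto := rewrite /shift; repeat (def_step; rewrite /shift).

(** * Arithmetization of evaluation *)

(* The finite set coded by [(a, b, N)], as in Goedel's beta function. *)
Definition fmem (a b N x : nat) : Prop := x < N /\ (b * x.+1).+1 %| a.

(** Eliminating the factorial from the two moduli, a common divisor divides [y - x], hence the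
    factorial of [N], hence [1]. *)
Lemma coprime_beta N x y : x < y -> y <= N ->
  coprime (N`! * x.+1).+1 (N`! * y.+1).+1.
Proof.
move=> lt_xy le_yN; rewrite /coprime; set d := gcdn _ _.
have dx : d %| (N`! * x.+1).+1 by exact: dvdn_gcdl.
have dy : d %| (N`! * y.+1).+1 by exact: dvdn_gcdr.
have db : d %| N`!.
  apply: (@dvdn_trans (y - x)); last by apply: dvdn_fact; lia.
  have := dvdn_sub (dvdn_mull y.+1 dx) (dvdn_mull x.+1 dy).
  by congr (_ %| _); nia.
by move: dx; rewrite -addn1 dvdn_addr ?dvdn1 // dvdn_mulr.
Qed.

(** The product of the moduli of the elements of [L] is divisible by each of them and coprime to
    every other modulus below [N]. *)
Lemma fmem_seq (L : seq nat) :
  exists a b N, forall x, fmem a b N x <-> x \in L.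
Proof.
pose N := (\max_(y <- L) y).+1.
have ltN x : x \in L -> x < N by move=> xL; rewrite ltnS; exact: leq_bigmax_seq.
exists (\prod_(y <- L) (N`! * y.+1).+1), (N`!), N => x.
split=> [[lt_xN]|xL]; last first.
  split; first exact: ltN.
  by rewrite (big_rem x) //= dvdn_mulr.
apply: contraTT => xL; set p := \prod_(_ <- _) _.
suff cop : coprime (N`! * x.+1).+1 p.
  apply/negP => dv; move: cop; rewrite /coprime (gcdn_idPl dv) eqSS muln_eq0.
  by rewrite orbF -leqn0 leqNgt fact_gt0.
rewrite /p big_seq; elim/big_rec: _ => [|y q yL cop]; first exact: coprimen1.
rewrite coprimeMr cop andbT; have := ltN _ yL => lt_yN.
case: (ltngtP x y) => [lt|lt|E].
- by apply: coprime_beta; lia.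
- by rewrite coprime_sym; apply: coprime_beta; lia.
- by rewrite E yL in xL.
Qed.

(** One layer of [eval] on Goedel numbers, with recursive calls delegated to [S]; finite sets closed
    backwards under it serve as derivations. *)
Definition eval_step (S : nat -> nat -> nat -> Prop) (e n m : nat) : Prop :=
  (e = 0 /\ m = 0) \/
  (e = 1 /\ m = n.+1) \/
  (e = 2 /\ exists b, n = cpair m b) \/
  (e = 3 /\ exists a, n = cpair a m) \/
  (exists e1 e2, e = 4 * cpair e1 e2 + 4 /\
     exists a b, m = cpair a b /\ S e1 n a /\ S e2 n b) \/
  (exists e1 e2, e = 4 * cpair e1 e2 + 5 /\
     exists a, S e2 n a /\ S e1 a m) \/
  (exists e1 e2, e = 4 * cpair e1 e2 + 6 /\
     exists a, (n = cpair a 0 /\ S e1 a m) \/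
       exists k r, n = cpair a k.+1 /\ S e (cpair a k) r /\
                   S e2 (cpair a (cpair k r)) m) \/
  (exists e1, e = 4 * e1 + 7 /\ S e1 (cpair n m) 0 /\
     forall i, i < m -> exists r, S e1 (cpair n i) r.+1).

Lemma eval_step_mono (S S' : nat -> nat -> nat -> Prop) e n m :
  (forall e n m, S e n m -> S' e n m) -> eval_step S e n m -> eval_step S' e n m.
Proof.
move=> H [?|[?|[?|[?|[|[|[|]]]]]]].
- by left.
- by right; left.
- by do 2 right; left.
- by do 3 right; left.
- move=> [e1 [e2 [Ee [a [b [Em [/H Ha /H Hb]]]]]]].
  by do 4 right; left; exists e1, e2; split=> //; exists a, b.
- move=> [e1 [e2 [Ee [a [/H Ha /H Hb]]]]].
  by do 5 right; left; exists e1, e2; split=> //; exists a.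
- move=> [e1 [e2 [Ee [a Ha]]]].
  do 6 right; left; exists e1, e2; split=> //; exists a.
  case: Ha => [[En /H]|[k [r [En [/H Hr /H Hm]]]]]; first by left.
  by right; exists k, r.
- move=> [e1 [Ee [/H H0 Hlt]]]; do 7 right; exists e1; split=> //; split=> // i.
  by move=> /Hlt[r /H]; exists r.
Qed.

Ltac absurd_code := first
  [ by move=> [Ee _]; lia | by move=> [? [Ee _]]; lia
  | by move=> [? [? [Ee _]]]; lia ].

(** By induction on the code; at [CPrec] the code recurs unchanged, and an inner induction on the
    counter takes over. *)
Lemma eval_step_sound (S : nat -> nat -> nat -> Prop) :
  (forall e n m, S e n m -> eval_step S e n m) ->
  forall c n m, S (encode c) n m -> eval c n m.
Proof.
move=> HS; elim=> [||||c IHc d IHd|c IHc d IHd|c IHc d IHd|c IHc] n m /=.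
- move=> /HS; rewrite /eval_step; firstorder lia.
- move=> /HS; rewrite /eval_step; firstorder lia.
- move=> /HS; rewrite /eval_step; firstorder lia.
- move=> /HS; rewrite /eval_step; firstorder lia.
- move=> /HS[|[|[|[|[|[|[|]]]]]]]; try absurd_code.
  move=> [e1 [e2 [Ee [a [b [-> [Ha Hb]]]]]]].
  have [E1 E2] : encode c = e1 /\ encode d = e2 by apply: cpair_inj; lia.
  by exists a, b; split=> //; [apply: IHc | apply: IHd]; rewrite ?E1 ?E2.
- move=> /HS[|[|[|[|[|[|[|]]]]]]]; try absurd_code.
  move=> [e1 [e2 [Ee [a [Ha Hb]]]]].
  have [E1 E2] : encode c = e1 /\ encode d = e2 by apply: cpair_inj; lia.
  by exists a; split; [apply: IHd | apply: IHc]; rewrite ?E1 ?E2.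
- move=> Hn; exists (pfst n), (psnd n); split; first by rewrite cpairK.
  move: Hn; rewrite -{1}(cpairK n).
  elim: (psnd n) m => [|k IHk] m /HS[|[|[|[|[|[|[|]]]]]]];
    try absurd_code.
    move=> [e1 [e2 [Ee [a]]]].
    have [E1 E2] : encode c = e1 /\ encode d = e2 by apply: cpair_inj; lia.
    case=> [[/cpair_inj[<- _]]|[k [r [/cpair_inj[_ //]]]]].
    by rewrite -E1; exact: IHc.
  move=> [e1 [e2 [Ee [a]]]].
  have [E1 E2] : encode c = e1 /\ encode d = e2 by apply: cpair_inj; lia.
  case=> [[/cpair_inj[_ //]]|[k' [r [/cpair_inj[<- [<-]] [/IHk Hr]]]]].
  by rewrite -E2 => /IHd Hm; exists r.
- move=> /HS[|[|[|[|[|[|[|]]]]]]]; try absurd_code.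
  move=> [e1 [Ee [H0 Hlt]]]; have E1 : encode c = e1 by lia.
  rewrite -E1 in H0 Hlt; split; first exact: IHc.
  by move=> i /Hlt[r /IHc]; exists r.
Qed.

Definition triple (e n m : nat) : nat := cpair e (cpair n m).

Definition derivation (L : seq nat) : Prop :=
  forall e n m, triple e n m \in L ->
    eval_step (fun e n m => triple e n m \in L) e n m.

Lemma derivation_cat L L' :
  derivation L -> derivation L' -> derivation (L ++ L').
Proof.
move=> HL HL' e n m; rewrite mem_cat => /orP[/HL|/HL'];
  by apply: eval_step_mono => ? ? ?; rewrite mem_cat => ->; rewrite ?orbT.
Qed.

Lemma derivation_cons L e n m : derivation L ->
  eval_step (fun e n m => triple e n m \in L) e n m ->
  derivation (triple e n m :: L).
Proof.
have sub e' n' m' : triple e' n' m' \in L -> triple e' n' m' \in triple e n m :: L.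
  by rewrite in_cons orbC => ->.
move=> HL H e' n' m'; rewrite in_cons => /orP[/eqP|/HL]; last first.
  exact: eval_step_mono.
move=> /cpair_inj[-> /cpair_inj[-> ->]]; exact: eval_step_mono H.
Qed.

(** Derivations of the subcomputations are concatenated and the conclusion is put in front. An
    unbounded search contributes only the finitely many trials up to its result. *)
Lemma derivation_exists c n m : eval c n m ->
  exists L, derivation L /\ triple (encode c) n m \in L.
Proof.
have last L e n' m' : derivation L ->
    eval_step (fun e n m => triple e n m \in L) e n' m' ->
    exists L, derivation L /\ triple e n' m' \in L.
  move=> HL Hs; exists (triple e n' m' :: L); split; last exact: mem_head.
  exact: derivation_cons.
have nil : derivation [::] by [].
elim: c n m => [||||c IHc d IHd|c IHc d IHd|c IHc d IHd|c IHc] n m /=.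
- by move=> ->; apply: last nil _; left.
- by move=> ->; apply: last nil _; right; left.
- by move=> H; apply: last nil _; do 2 right; left.
- by move=> H; apply: last nil _; do 3 right; left.
- move=> [a [b [/IHc[L [HL inL]] /IHd[L' [HL' inL']] ->]]].
  apply: last (derivation_cat HL HL') _; do 4 right; left.
  exists (encode c), (encode d); split=> //; exists a, b.
  by rewrite !mem_cat inL inL' orbT.
- move=> [a [/IHd[L [HL inL]] /IHc[L' [HL' inL']]]].
  apply: last (derivation_cat HL HL') _; do 5 right; left.
  exists (encode c), (encode d); split=> //; exists a.
  by rewrite !mem_cat inL inL' orbT.
- move=> [a [k [-> H]]].
  elim: k m H => [|k IHk] m.
    move=> /IHc[L [HL inL]]; apply: last HL _; do 6 right; left.
    by exists (encode c), (encode d); split=> //; exists a; left.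
  move=> [r [/IHk[L [HL inL]] /IHd[L' [HL' inL']]]].
  apply: last (derivation_cat HL HL') _; do 6 right; left.
  exists (encode c), (encode d); split=> //; exists a; right; exists k, r.
  by rewrite !mem_cat inL inL' orbT.
- move=> [/IHc[L0 [HL0 inL0]] Hlt].
  have [L [HL inL]] : exists L, derivation L /\
      forall i, i < m -> exists r, triple (encode c) (cpair n i) r.+1 \in L.
    elim: m Hlt {inL0} => [|m IHm] Hlt; first by exists [::].
    have [|L [HL inL]] := IHm; first by move=> i lt_i; apply: Hlt; lia.
    have [r /IHc[L' [HL' inL']]] := Hlt m (ltnSn m).
    exists (L ++ L'); split=> [|i]; first exact: derivation_cat.
    rewrite ltnS leq_eqVlt => /orP[/eqP->|/inL[r' Hr']].
      by exists r; rewrite mem_cat inL' orbT.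
    by exists r'; rewrite mem_cat Hr'.
  apply: last (derivation_cat HL0 HL) _; do 7 right; exists (encode c).
  split=> //; split=> [|i /inL[r Hr]]; first by rewrite mem_cat inL0.
  by exists r; rewrite mem_cat Hr orbT.
Qed.

Definition evalc (e n m : nat) : Prop := exists c, e = encode c /\ eval c n m.

Lemma evalcE c n m : evalc (encode c) n m <-> eval c n m.
Proof. by split=> [[d [/encode_inj->]]//|H]; exists c. Qed.

(** Kleene's normal form: a computation halts with a given output iff some coded finite derivation
    contains its triple. *)
Lemma def_evalc f g h : defn f -> defn g -> defn h ->
  def (fun v => evalc (f v) (g v) (h v)).
Proof.
apply: (@def_rel3 evalc).
have : def (fun v => exists a b N,
    (forall e n m, fmem a b N (triple e n m) ->
       eval_step (fun e n m => fmem a b N (triple e n m)) e n m) /\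
    fmem a b N (triple (v 0) (v 1) (v 2))).
  rewrite /eval_step /fmem /triple; def_auto.
apply: def_ext => v; have [c Ec] := encode_surj (v 0); split.
  move=> [a [b [N [HS]]]]; rewrite -Ec => H.
  apply/evalcE; exact: (eval_step_sound HS).
rewrite -Ec => /evalcE/derivation_exists[L [HL inL]].
have [a [b [N memE]]] := fmem_seq L; exists a, b, N; split; last exact/memE.
move=> e n m /memE/HL; apply: eval_step_mono => ? ? ?; exact: iffRL (memE _).
Qed.

Lemma defn_computable f g : computable f -> defn g -> defn (fun v => f (g v)).
Proof.
move=> [c Hc] Hg; rewrite /defn.
have : def (fun v => evalc (encode c) (g (shift v)) (v 0)).
  by apply: def_evalc; [exact: defn_const | exact: defn_shift | exact: defn_var].
apply: def_ext => v; rewrite evalcE; split=> [H|->//]; exact: eval_inj H (Hc _).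
Qed.

Lemma defn_exp2 f : defn f -> defn (fun v => 2 ^ f v).
Proof. exact: defn_computable computable_exp2. Qed.

Lemma def_bit f g : defn f -> defn g -> def (fun v => bit (f v) (g v)).
Proof.
apply: (@def_rel2 (fun s i => bit s i)).
have : def (fun v => exists q r p,
    v 0 = (2 * q + 1) * p + r /\ r < p /\ p = 2 ^ v 1).
  def_auto; exact: defn_exp2 (defn_var 4).
apply: def_ext => v; split=> [[q [r [p [-> [lt_r Ep]]]]]|].
  rewrite /bit -Ep divnMDl; last by lia.
  by rewrite divn_small // addn0; lia.
rewrite /bit => Hodd; exists (v 0 %/ 2 ^ v 1)./2, (v 0 %% 2 ^ v 1), (2 ^ v 1).
rewrite ltn_pmod ?expn_gt0 //; split=> //.
rewrite {1}(divn_eq (v 0) (2 ^ v 1)); congr (_ * _ + _); lia.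
Qed.

(** * Open predicates and compactness of Cantor space *)

(** Families of open sets of reals given by arithmetical data, uniformly in number parameters.
    Universal quantifiers are bounded because only finite intersections preserve openness. *)
Inductive op : (env -> real -> Prop) -> Prop :=
| op_def P : def P -> op (fun v _ => P v)
| op_pos f : defn f -> op (fun v X => X (f v))
| op_neg f : defn f -> op (fun v X => ~~ X (f v))
| op_and Q R : op Q -> op R -> op (fun v X => Q v X /\ R v X)
| op_or Q R : op Q -> op R -> op (fun v X => Q v X \/ R v X)
| op_scons Q : op Q -> op (fun v X => exists n, Q (n .: v) X)
| op_bscons f Q : defn f -> op Q ->
    op (fun v X => forall n, n < f v -> Q (n .: v) X).

Lemma op_ext Q R : (forall v X, Q v X <-> R v X) -> op Q -> op R.
Proof.
move=> H; have -> // : Q = R.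
by apply: funext => v; apply: funext => X; apply: propext.
Qed.

Lemma op_ex (Q : nat -> env -> real -> Prop) :
  op (fun v X => Q (v 0) (shift v) X) -> op (fun v X => exists n, Q n v X).
Proof. by move=> H; exact: op_scons H. Qed.

Lemma op_ball f (Q : nat -> env -> real -> Prop) :
  defn f -> op (fun v X => Q (v 0) (shift v) X) ->
  op (fun v X => forall n, n < f v -> Q n v X).
Proof. by move=> Hf H; exact: op_bscons Hf H. Qed.

(** Substitution also reindexes the real by a definable map; this covers preimages under [evens],
    [odds] and [column]. *)
Lemma op_subst Q : op Q ->
  forall (s : nat -> env -> nat) (h : env -> nat -> nat),
  (forall i, defn (s i)) -> defn (fun v => h (shift v) (v 0)) ->
  op (fun v X => Q (s^~ v) (fun k => X (h v k))).
Proof.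
have comp f s h : defn f -> (forall i, defn (s i)) ->
    defn (fun v => h (shift v) (v 0)) -> defn (fun v => h v (f (s^~ v))).
  move=> Hf Hs Hh.
  apply: (defn_subst Hh (s := fun i v => (f (s^~ v) .: v) i)) => -[|i] /=.
    exact: defn_subst.
  exact: defn_var.
have lift h : defn (fun v => h (shift v) (v 0)) ->
    defn (fun v => h (shift (shift v)) (v 0)).
  move=> Hh; apply: (defn_subst Hh
    (s := fun i v => v (if i is i'.+1 then i'.+2 else 0))).
  by move=> i; exact: defn_var.
elim=> {Q} [P HP|f Hf|f Hf|Q R _ IHQ _ IHR|Q R _ IHQ _ IHR|Q _ IH|f Q Hf _ IH]
  s h Hs Hh.
- exact: op_def (def_subst HP Hs).
- exact: op_pos (comp _ _ _ Hf Hs Hh).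
- exact: op_neg (comp _ _ _ Hf Hs Hh).
- by apply: op_and; [exact: IHQ | exact: IHR].
- by apply: op_or; [exact: IHQ | exact: IHR].
- have := op_scons (IH _ (fun v => h (shift v)) (defn_up Hs) (lift _ Hh)).
  by apply: op_ext => v X; split=> -[n Hn]; exists n; rewrite up_scons in Hn *.
- have := op_bscons (defn_subst Hf Hs)
    (IH _ (fun v => h (shift v)) (defn_up Hs) (lift _ Hh)).
  by apply: op_ext => v X; split=> H n /H; rewrite up_scons.
Qed.

Lemma op_env Q (s : nat -> env -> nat) : op Q -> (forall i, defn (s i)) ->
  op (fun v X => Q (s^~ v) X).
Proof. by move=> HQ Hs; exact: (op_subst HQ (h := fun _ k => k) Hs (defn_var 0)). Qed.

Lemma op_not_def P : def P -> op (fun v _ => ~ P v).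
Proof. by move=> HP; apply: op_def; apply: def_not. Qed.

Definition is_segment (s : nat) (X : real) : Prop := exists k, s = segment X k.

Lemma op_segment f g : defn f -> defn g ->
  op (fun v X => f v = segment X (g v)).
Proof.
move=> Hf Hg.
suff H : op (fun v X => v 0 = segment X (v 1)).
  apply: (op_env (s := fun i v => if i == 0 then f v else g v) H).
  by case.
have : op (fun v X => exists s, (v 0 = cpair (v 1) s /\ s < 2 ^ v 1) /\
    forall i, i < v 1 ->
      (X i /\ bit s i) \/ (~~ X i /\ ~ bit s i)).
  apply: op_ex; apply: op_and; first (apply: op_def; def_auto).
    exact: defn_exp2 (defn_var 2).
  apply: op_ball; rewrite /shift; first exact: defn_var.
  apply: op_or; apply: op_and.
  - exact: op_pos (defn_var 0).
  - by apply: op_def; apply: def_bit; exact: defn_var.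
  - exact: op_neg (defn_var 0).
  - by apply: op_not_def; apply: def_bit; exact: defn_var.
apply: op_ext => v X; split=> [[s [[-> lt_s] H]]|->].
  apply/segmentP; split=> // i /H; by case: (X i) (bit s i) => [] [] [] [].
exists (bits X (v 1)); rewrite segmentE bits_lt; split=> // i lt_i.
by rewrite bit_bits //; case: (X i); [left | right].
Qed.

(** A failure shows in a number too large for its length or in one wrong bit. *)
Lemma op_not_segment f : defn f -> op (fun v X => ~ is_segment (f v) X).
Proof.
move=> Hf; suff H : op (fun v X => ~ is_segment (v 0) X).
  exact: (op_env (s := fun i => f) H).
have : op (fun v X => exists k s, v 0 = cpair k s /\ (~ s < 2 ^ k \/
    exists i, i < k /\ ((X i /\ ~ bit s i) \/ (~~ X i /\ bit s i)))).
  apply: op_ex; apply: op_ex; apply: op_and; first (apply: op_def; def_auto).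
  apply: op_or; first (apply: op_def; def_auto).
    exact: defn_exp2 (defn_var 1).
  apply: op_ex; rewrite /shift; apply: op_and; first (apply: op_def; def_auto).
  apply: op_or; apply: op_and.
  - exact: op_pos (defn_var 0).
  - by apply: op_not_def; apply: def_bit; exact: defn_var.
  - exact: op_neg (defn_var 0).
  - by apply: op_def; apply: def_bit; exact: defn_var.
apply: op_ext => v X; split.
  move=> [k [s [-> H]]] [k' E].
  have Ek : k = k' by have [] := cpair_inj E.
  move: E; rewrite -Ek => /segmentP[lt_s Hb].
  case: H => [//|[i [/Hb-> ]]]; by case: bit => -[] [].
move=> H; exists (pfst (v 0)), (psnd (v 0)); rewrite cpairK; split=> //.
apply: contrapT => Hn; apply: H; exists (pfst (v 0)); rewrite -{1}(cpairK (v 0)).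
apply/segmentP; split; first by apply: contrapT => ?; apply: Hn; left.
move=> i lt_i; apply: contrapT => ne; apply: Hn; right; exists i; split=> //.
by case: (X i) (bit _ i) ne => [] [] // _; [left | right].
Qed.

Definition persistent (w : nat -> Prop) : Prop :=
  forall X k k', k <= k' -> w (segment X k) -> w (segment X k').

(** An open family is generated by an arithmetical set of segments. Persistence allows several
    thresholds to be replaced by their maximum, which settles conjunctions and bounded
    quantifiers. *)
Lemma op_normal_form Q : op Q -> exists w : env -> Prop,
  [/\ def w, forall v, persistent (fun s => w (s .: v)) &
      forall v X, Q v X <-> exists k, w (segment X k .: v)].
Proof.
elim=> {Q} [P HP|f Hf|f Hf|Q R _ IHQ _ IHR|Q R _ IHQ _ IHR|Q _ IH|f Q Hf _ IH].
- exists (fun v => P (shift v)); split; first exact: def_shift.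
    by move=> v X k k' _.
  by move=> v X; split=> [H|[]//]; exists 0.
- exists (fun v => exists k s, v 0 = cpair k s /\
    (f (shift v) < k /\ bit s (f (shift v)))); split.
  + apply: def_ex; apply: def_ex; apply: def_and; first by def_auto.
    have Hf3 : defn (fun v => f (shift (shift (shift v)))).
      exact: defn_shift (defn_shift (defn_shift Hf)).
    apply: def_and; first (apply: def_leq; last exact: defn_var).
      exact: defn_succ Hf3.
    by apply: def_bit Hf3; exact: defn_var.
  + move=> v X k k' le_k [k1 [s [/= /cpair_inj[<- <-] [lt_f]]]].
    rewrite bit_bits // => Xf; exists k', (bits X k'); split=> //=.
    by rewrite bit_bits ?(leq_trans lt_f).
  + move=> v X; split=> [Xf|[k [k1 [s [/= /cpair_inj[<- <-] [lt_f]]]]]].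
      exists (f v).+1, (f v).+1, (bits X (f v).+1); split=> //=.
      by rewrite bit_bits.
    by rewrite bit_bits.
- exists (fun v => exists k s, v 0 = cpair k s /\
    (f (shift v) < k /\ ~ bit s (f (shift v)))); split.
  + apply: def_ex; apply: def_ex; apply: def_and; first by def_auto.
    have Hf3 : defn (fun v => f (shift (shift (shift v)))).
      exact: defn_shift (defn_shift (defn_shift Hf)).
    apply: def_and; first (apply: def_leq; last exact: defn_var).
      exact: defn_succ Hf3.
    by apply: def_not; apply: def_bit Hf3; exact: defn_var.
  + move=> v X k k' le_k [k1 [s [/= /cpair_inj[<- <-] [lt_f]]]].
    rewrite bit_bits // => Xf; exists k', (bits X k'); split=> //=.
    by rewrite bit_bits ?(leq_trans lt_f).
  + move=> v X; split=> [/negP Xf|[k [k1 [s [/= /cpair_inj[<- <-] [lt_f]]]]]].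
      exists (f v).+1, (f v).+1, (bits X (f v).+1); split=> //=.
      by rewrite bit_bits.
    by rewrite bit_bits // => /negP.
- have [w1 [Hw1 P1 E1]] := IHQ; have [w2 [Hw2 P2 E2]] := IHR.
  exists (fun v => w1 v /\ w2 v); split; first exact: def_and.
    by move=> v X k k' le [H1 H2]; split; [apply: P1 H1 | apply: P2 H2].
  move=> v X; rewrite E1 E2; split=> [[[k Hk] [l Hl]]|[k [H1 H2]]].
    exists (maxn k l); split; [apply: P1 Hk | apply: P2 Hl];
      by rewrite leq_max leqnn ?orbT.
  by split; exists k.
- have [w1 [Hw1 P1 E1]] := IHQ; have [w2 [Hw2 P2 E2]] := IHR.
  exists (fun v => w1 v \/ w2 v); split; first exact: def_or.
    by move=> v X k k' le [H1|H2]; [left; apply: P1 H1 | right; apply: P2 H2].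
  move=> v X; rewrite E1 E2; split=> [[[k Hk]|[k Hk]]|[k [H|H]]].
  + by exists k; left.
  + by exists k; right.
  + by left; exists k.
  + by right; exists k.
- have [w [Hw Pw Ew]] := IH.
  exists (fun v => exists n, w (v 0 .: n .: shift v)); split.
  (* Under the quantifier the number is at position [0] and the segment at [1], the reverse of what
     [w] expects. *)
  + apply: def_ex; apply: (def_subst Hw
      (s := fun i v => (v 1 .: v 0 .: shift (shift v)) i)).
    by move=> [|[|i]]; exact: defn_var.
  + by move=> v X k k' le [n Hn]; exists n; apply: Pw Hn.
  + move=> v X; split=> [[n /Ew[k Hk]]|[k [n Hn]]]; first by exists k, n.
    by exists n; apply/Ew; exists k.
- have [w [Hw Pw Ew]] := IH.
  exists (fun v => forall n, n < f (shift v) -> w (v 0 .: n .: shift v)); split.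
  + apply: def_all; apply: def_imp.
      apply: def_leq; first exact: defn_succ (defn_var 0).
      exact: defn_shift (defn_shift Hf).
    apply: (def_subst Hw (s := fun i v => (v 1 .: v 0 .: shift (shift v)) i)).
    by move=> [|[|i]]; exact: defn_var.
  + by move=> v X k k' le H n lt_n; apply: Pw le _; apply: H.
  + move=> v X; split=> [H|[k Hk] n lt_n]; last by apply/Ew; exists k; apply: Hk.
    have {}H : forall n, n < f v -> exists k, w (segment X k .: n .: v).
      by move=> n /H/Ew.
    rewrite /shift /=; elim: (f v) H => [|m IHm] H; first by exists 0.
    have [|k Hk] := IHm; first by move=> n lt_n; apply: H; lia.
    have [l Hl] := H m (ltnSn m).
    exists (maxn k l) => n; rewrite ltnS leq_eqVlt => /orP[/eqP->|lt_n].
      by apply: Pw Hl; rewrite leq_max leqnn orbT.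
    by apply: Pw (Hk _ lt_n); rewrite leq_max leqnn.
Qed.

Definition prefix_of (s : seq bool) (X : real) : Prop :=
  forall i, i < size s -> X i = nth false s i.

(** Koenig's lemma: if no length works uniformly, the root is unbarred, every unbarred node has an
    unbarred child, and choice yields a branch contradicting the bar. *)
Lemma fan (w : nat -> Prop) : persistent w ->
  (forall X, exists k, w (segment X k)) ->
  exists k, forall X, w (segment X k).
Proof.
move=> Pw Hbar; apply: contrapT => /forallNP Hn.
pose unbarred s := forall k, exists X, prefix_of s X /\ ~ w (segment X k).
have ext s : unbarred s -> exists b, unbarred (rcons s b).
  move=> Hs; apply: contrapT => /forallNP Hb.
  have /existsNP[k0 H0] := Hb false; have /existsNP[k1 H1] := Hb true.
  (* If both children were barred, by persistence the larger of their bounds would bar [s]. *)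
  have [X [sX HX]] := Hs (maxn k0 k1).
  have pX : prefix_of (rcons s (X (size s))) X.
    move=> i; rewrite size_rcons ltnS leq_eqVlt nth_rcons => /orP[/eqP->|lt_i].
      by rewrite ltnn eqxx.
    by rewrite lt_i; apply: sX.
  case E : (X (size s)) pX => pX; [apply: H1 | apply: H0]; exists X; split=> //;
    by move=> H; apply: HX; apply: Pw H; rewrite leq_max leqnn ?orbT.
have /choice[next Hnext] :
    forall s, exists b, unbarred s -> unbarred (rcons s b).
  move=> s; case: (pselect (unbarred s)) => [/ext[b Hb]|Hs]; first by exists b.
  by exists false.
pose path := fix path k :=
  if k is k'.+1 then rcons (path k') (next (path k')) else [::].
have sz k : size (path k) = k by elim: k => //= k IH; rewrite size_rcons IH.
have unb k : unbarred (path k).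
  elim: k => [|k IH]; last exact: Hnext.
  by move=> k; have /existsNP[X HX] := Hn k; exists X.
pose X : real := fun i => next (path i).
have pathE k i : i < k -> nth false (path k) i = X i.
  elim: k => // k IH; rewrite ltnS leq_eqVlt /= nth_rcons sz => /orP[/eqP->|lt].
    by rewrite ltnn eqxx.
  by rewrite lt IH.
(* Where the branch [X] is barred, an extension of [path k] that avoids [w] has the same segment as
   [X]. *)
have [k Hk] := Hbar X; have [Y [pY HY]] := unb k k; apply: HY.
by rewrite (@eq_segment Y X) // => i lt_i; rewrite pY ?sz // pathE.
Qed.

(** Compactness replaces the quantifier over reals by one length [k] at which all [2 ^ k] segments
    satisfy [w]. *)
Lemma def_forall_op Q : op Q -> def (fun v => forall X, Q v X).
Proof.
move=> /op_normal_form[w [Hw Pw Ew]].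
have : def (fun v => exists k, forall s, s < 2 ^ k -> w (cpair k s .: v)).
  apply: def_ex; apply: def_all; apply: def_imp.
    apply: def_leq; first exact: defn_succ (defn_var 0).
    exact: defn_exp2 (defn_var 1).
  apply: def_consrel => // [|i]; last exact: defn_var.
  by apply: defn_cpair; exact: defn_var.
apply: def_ext => v; split=> [[k Hk] X|H].
  by apply/Ew; exists k; apply: Hk; exact: bits_lt.
have [k Hk] : exists k, forall X, w (segment X k .: v).
  by apply: (fan (Pw v)) => X; apply/Ew.
exists k => s lt_s; have := Hk (bit s); congr (w (_ .: v)).
by apply/esym/segmentP; split.
Qed.

(* The predicate under the quantifier is not open; but [G v X] is decided by
   an initial segment of [X], and a segment [s] admits no extension outside
   [N] iff every [X] lies in [N] or does not extend [s], which is open. *)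
Lemma def_forall_op_not N G : op N -> op G ->
  def (fun v => forall X, N v X \/ ~ G v X).
Proof.
move=> HN /op_normal_form[w [Hw Pw Ew]].
have : def (fun v => forall s, w (s .: v) ->
    forall X, N v X \/ ~ is_segment s X).
  apply: def_all; apply: def_imp.
    by apply: def_consrel => // [|i]; exact: defn_var.
  apply: def_forall_op; apply: op_or; last exact: op_not_segment (defn_var 0).
  by apply: (op_env (s := fun i v => shift v i) HN) => i; exact: defn_var.
apply: def_ext => v; split=> [H X|H s Hs X].
  case: (pselect (G v X)) => [/Ew[k Hk]|]; last by right.
  by have [|[]] := H _ Hk X; [left | exists k].
case: (H X) => [|nG]; first by left.
by right=> -[k Es]; apply: nG; apply/Ew; exists k; rewrite -Es.
Qed.

(** * Classical truth *)

Fixpoint box_free (A : form) : Prop :=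
  match A with
  | FEq _ _ | FLt _ _ => True
  | FNot B | FEx _ B | FAll _ B => box_free B
  | FAnd B C | FOr B C | FImp B C => box_free B /\ box_free C
  | FBox _ => False
  end.

Lemma arithmetical_box_free A : arithmetical A -> box_free A.
Proof.
elim: A => //= [B IHB|B IHB C IHC|B IHB C IHC|B IHB C IHC|x B IHB|x B IHB|B IHB] H.
- by apply: IHB => D HD; apply: (H D); right.
- by split; [apply: IHB | apply: IHC] => D HD; apply: (H D); right; [left | right].
- by split; [apply: IHB | apply: IHC] => D HD; apply: (H D); right; [left | right].
- by split; [apply: IHB | apply: IHC] => D HD; apply: (H D); right; [left | right].
- by apply: IHB => D HD; apply: (H D); right.
- by apply: IHB => D HD; apply: (H D); right.
- by apply: (H B); left.
Qed.

Lemma box_free_arithmetical A : box_free A -> arithmetical A.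
Proof.
move=> H D; elim: A H => //= [s t|s t|B IHB|B IHB C IHC|B IHB C IHC|B IHB C IHC|x B IHB|x B IHB].
- by move=> _ [].
- by move=> _ [].
- by move=> /IHB nB [].
- by move=> [/IHB nB /IHC nC] [|[]].
- by move=> [/IHB nB /IHC nC] [|[]].
- by move=> [/IHB nB /IHC nC] [|[]].
- by move=> /IHB nB [].
- by move=> /IHB nB [].
Qed.

(* The value at [FBox] is junk. *)
Fixpoint csat (v : env) (A : form) : Prop :=
  match A with
  | FEq s t => tval v s = tval v t
  | FLt s t => tval v s < tval v t
  | FNot B => ~ csat v B
  | FAnd B C => csat v B /\ csat v C
  | FOr B C => csat v B \/ csat v C
  | FImp B C => csat v B -> csat v C
  | FEx x B => exists n, csat (upd v x n) B
  | FAll x B => forall n, csat (upd v x n) B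
  | FBox _ => False
  end.

Lemma blank_realizer (T : Prop) : (exists X : real, T /\ X =1 pred0) <-> T.
Proof. by split=> [[X []]//|HT]; exists pred0. Qed.

(* An implication is realized by a constant map as soon as its conclusion is
   realized, and by anything if its antecedent is not. *)
Lemma csat_witness A v : box_free A -> csat v A <-> exists X, witness v A X.
Proof.
elim: A v => //= [s t|s t|B IHB|B IHB C IHC|B IHB C IHC|B IHB C IHC|x B IHB|x B IHB] v.
- by rewrite blank_realizer.
- by rewrite blank_realizer.
- by move=> /IHB EB; rewrite blank_realizer EB.
- move=> [/IHB EB /IHC EC]; rewrite EB EC; split=> [[[X HX] [Y HY]]|[X [HX HY]]].
    by exists (join X Y); rewrite evens_join odds_join.
  by split; [exists (evens X) | exists (odds X)].
- move=> [/IHB EB /IHC EC]; rewrite EB EC; split=> [[[X HX]|[X HX]]|].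
  + by exists (join (pred1 0) X); rewrite evens_join odds_join; left.
  + by exists (join (pred1 1) X); rewrite evens_join odds_join; right.
  + by move=> [X [[_ HX]|[_ HX]]]; [left | right]; exists (odds X).
- move=> [/IHB EB /IHC EC]; rewrite EB EC; split=> [H|[W HW] [X /HW[Z [_ HZ]]]].
    case: (pselect (exists X, witness v B X)) => [/H[Z HZ]|nB]; last first.
      by exists pred0 => Y HY; case: nB; exists Y.
    (* The input segment [pfst p] is ignored: this codes the constant map with value [Z]. *)
    exists (fun p => psnd (psnd p) == Z (pfst (psnd p))) => Y _; exists Z.
    split=> // n b; split=> [<-|[k]]; first by exists 0; rewrite !(pfstK, psndK).
    by rewrite !(pfstK, psndK); case: (Z n) b => [] [].
  by exists Z.
- move=> bB; split=> [[n /IHB-/(_ bB)[X HX]]|[X [n [_ HX]]]].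
    by exists (join (pred1 n) X), n; rewrite evens_join odds_join.
  by exists n; apply/IHB => //; exists (odds X).
- move=> bB; split=> [H|[X HX] n]; last by apply/IHB => //; exists (column X n).
  have /choice[F HF] : forall n, exists X, witness (upd v x n) B X.
    by move=> n; apply/IHB.
  by exists (columns F) => n; rewrite column_columns.
Qed.

Lemma def_upd P x : def P -> def (fun v => P (upd (shift v) x (v 0))).
Proof.
move=> HP; apply: (def_subst HP (s := fun i v => upd (shift v) x (v 0) i)) => i.
by rewrite /upd; case: eqP => _; exact: defn_var.
Qed.

Lemma def_csat A : box_free A -> def (fun v => csat v A).
Proof.
elim: A => //= [s t _|s t _|B IHB|B IHB C IHC|B IHB C IHC|B IHB C IHC|x B IHB|x B IHB].
- exact: def_teq.
- by apply: def_leq; [apply: defn_succ|]; exact: defn_tval.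
- by move=> /IHB; exact: def_not.
- by move=> [/IHB HB /IHC HC]; exact: def_and.
- by move=> [/IHB HB /IHC HC]; exact: def_or.
- by move=> [/IHB HB /IHC HC]; exact: def_imp.
- by move=> /IHB HB; apply: def_ex; exact: def_upd HB.
- by move=> /IHB HB; apply: def_all; exact: def_upd HB.
Qed.

Lemma tval_agree t : exists K, forall v v' : env,
  (forall i, i < K -> v i = v' i) -> tval v t = tval v' t.
Proof.
elim: t => /= [x|||s [K HK] u [L HL]|s [K HK] u [L HL]]; try by exists 0.
- by exists x.+1 => v v'; apply.
- exists (maxn K L) => v v' H; rewrite (HK v v') ?(HL v v') //;
    by move=> i lt_i; apply: H; rewrite leq_max lt_i ?orbT.
- exists (maxn K L) => v v' H; rewrite (HK v v') ?(HL v v') //;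
    by move=> i lt_i; apply: H; rewrite leq_max lt_i ?orbT.
Qed.

(** Passes from positions to named variables. The bound [K] is carried along because a bound name
    must avoid the names of all relevant positions, and these must be finitely many. *)
Lemma def_formula P : def P ->
  exists K, (forall v v', (forall i, i < K -> v i = v' i) -> P v <-> P v') /\
    forall r, exists A, box_free A /\ forall v, csat v A <-> P (v \o r).
Proof.
elim=> {P} [s t|P Q _ [K [HK IHP]] _ [L [HL IHQ]]|P _ [K [HK IH]]|P _ [K [HK IH]]].
- have [K HK] := tval_agree s; have [L HL] := tval_agree t.
  exists (maxn K L); split=> [v v' H|r].
    rewrite (HK v v') ?(HL v v') //;
      by move=> i lt_i; apply: H; rewrite leq_max lt_i ?orbT.
  by exists (FEq (tren r s) (tren r t)); split=> // v /=; rewrite !tval_tren.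
- exists (maxn K L); split=> [v v' H|r].
    rewrite (HK v v') ?(HL v v') //;
      by move=> i lt_i; apply: H; rewrite leq_max lt_i ?orbT.
  have [A [bA EA]] := IHP r; have [B [bB EB]] := IHQ r.
  by exists (FAnd A B); split=> //= v; rewrite EA EB.
- exists K; split=> [v v' /HK->//|r]; have [A [bA EA]] := IH r.
  by exists (FNot A); split=> //= v; rewrite EA.
- exists K; split=> [v v' H|r].
    have E n : P (n .: v) <-> P (n .: v').
      by apply: HK => -[|i] //= lt_i; apply: H; exact: ltnW.
    by split=> -[n /E Hn]; exists n.
  pose z := (\max_(i < K) r i).+1.
  have [A [bA EA]] := IH (fun i => if i is i'.+1 then r i' else z).
  exists (FEx z A); split=> //= v.
  have E n : P (upd v z n \o (fun i => if i is i'.+1 then r i' else z)) <->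
      P (n .: v \o r).
    apply: HK => -[|i] lt_i /=; first by rewrite /upd eqxx.
    rewrite /upd; case: eqP => // Ez.
    have := @leq_bigmax _ (fun i : 'I_K => r i) (Ordinal (ltnW lt_i)).
    by rewrite /= Ez /z ltnn.
  by split=> -[n Hn]; exists n; [apply/E/EA | apply/EA/E].
Qed.

(** * Witnesses of antecedents form closed sets *)

(** A witness of a negation carries no information, so anything box-free may stand under one. *)
Fixpoint fan_form (A : form) : Prop :=
  match A with
  | FEq _ _ | FLt _ _ => True
  | FNot B => box_free B
  | FAnd B C | FOr B C => fan_form B /\ fan_form C
  | FEx x B => bounded_quantifier x B /\ fan_form B
  | FAll _ B => fan_form B
  | FImp _ _ | FBox _ => False
  end.

Lemma antecedent_fan_form A :
  box_free A -> imp_free A -> no_unbounded_ex A -> fan_form A.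
Proof.
elim: A => //= [B IHB C IHC|B IHB C IHC|B IHB C IHC|x B IHB|x B IHB].
- by move=> [bB bC] Hi Hx; split; [apply: IHB | apply: IHC] => //;
    [move=> D E HD; apply: (Hi D E) | move=> y D HD; apply: (Hx y D)
    | move=> D E HD; apply: (Hi D E) | move=> y D HD; apply: (Hx y D)];
    right; by [left | right].
- by move=> [bB bC] Hi Hx; split; [apply: IHB | apply: IHC] => //;
    [move=> D E HD; apply: (Hi D E) | move=> y D HD; apply: (Hx y D)
    | move=> D E HD; apply: (Hi D E) | move=> y D HD; apply: (Hx y D)];
    right; by [left | right].
- by move=> _ Hi _; apply: (Hi B C); left.
- move=> bB Hi Hx; split; first by apply: Hx; left.
  apply: IHB => // [D E HD|y D HD]; first by apply: (Hi D E); right.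
  by apply: Hx; right.
- move=> bB Hi Hx; apply: IHB => // [D E HD|y D HD].
    by apply: (Hi D E); right.
  by apply: (Hx y D); right.
Qed.

Lemma defn_double f : defn f -> defn (fun v => (f v).*2).
Proof.
by move=> Hf; apply: def_ext (defn_add Hf Hf) => v; rewrite addnn.
Qed.

Lemma op_evens Q : op Q -> op (fun v X => Q v (evens X)).
Proof.
move=> HQ; apply: (op_subst HQ (s := fun i v => v i) (h := fun _ => double)).
  by move=> i; exact: defn_var.
exact: defn_double (defn_var 0).
Qed.

Lemma op_odds Q : op Q -> op (fun v X => Q v (odds X)).
Proof.
move=> HQ; apply: (op_subst HQ (s := fun i v => v i) (h := fun _ k => k.*2.+1)).
  by move=> i; exact: defn_var.
exact: defn_succ (defn_double (defn_var 0)).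
Qed.

Lemma op_upd Q x : op Q -> op (fun v X => Q (upd (shift v) x (v 0)) X).
Proof.
move=> HQ; apply: (op_env (s := fun i v => upd (shift v) x (v 0) i) HQ) => i.
by rewrite /upd; case: eqP => _; exact: defn_var.
Qed.

Lemma op_not_blank P : def P -> op (fun v X => ~ (P v /\ X =1 pred0)).
Proof.
move=> HP; have : op (fun v X => ~ P v \/ exists n, X n).
  apply: op_or; first exact: op_not_def.
  by apply: op_ex; exact: op_pos (defn_var 0).
apply: op_ext => v X; split=> [[nP [//]|[n Xn] [_ /(_ n)]]|H].
  by rewrite Xn.
case: (pselect (P v)) => [Pv|]; [right | by left].
apply: contrapT => /forallNP HX; apply: H; split=> // n; exact/negP/HX.
Qed.

Lemma op_not_pred1 f : defn f -> op (fun v X => ~ X =1 pred1 (f v)).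
Proof.
move=> Hf; have : op (fun v X => exists n, (n = f v /\ ~~ X n) \/ (~ n = f v /\ X n)).
  have Hn : def (fun v => v 0 = f (shift v)) by [].
  apply: op_ex; apply: op_or; apply: op_and.
  - exact: op_def.
  - exact: op_neg (defn_var 0).
  - exact: op_not_def.
  - exact: op_pos (defn_var 0).
apply: op_ext => v X; split=> [[n Hn] /(_ n) /= E|H].
  by case: Hn => [[En]|[En]]; rewrite E; case: eqP.
apply: contrapT => /forallNP Hn; apply: H => n /=; have := Hn n.
by case: eqP => En; case: (X n) => // -[]; [left | right].
Qed.

Lemma tval_fv t v v' : {in tfv t, v =1 v'} -> tval v t = tval v' t.
Proof.
elim: t => //= [x|s IHs u IHu|s IHs u IHu] H.
- by apply: H; rewrite inE.
- by rewrite IHs ?IHu // => y Hy; apply: H; rewrite mem_cat Hy ?orbT.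
- by rewrite IHs ?IHu // => y Hy; apply: H; rewrite mem_cat Hy ?orbT.
Qed.

(** Closedness is expressed by openness of the complement: conjunctions and universal quantifiers
    become unions, and a bounded existential becomes a finite intersection. *)
Lemma op_not_witness A : fan_form A -> op (fun v X => ~ witness v A X).
Proof.
elim: A => //= [s t _|s t _|B _ bB|B IHB C IHC|B IHB C IHC|x B IHB|x B IHB].
- by apply: op_not_blank; exact: def_teq.
- apply: op_not_blank; apply: def_leq; last exact: defn_tval.
  by apply: defn_succ; exact: defn_tval.
- apply: op_not_blank; apply: def_ext (def_not (def_csat bB)) => v.
  by rewrite csat_witness.
- move=> [/IHB/op_evens HB /IHC/op_odds HC].
  by apply: op_ext (op_or HB HC) => v X; rewrite not_andE.
- move=> [/IHB/op_odds HB /IHC/op_odds HC].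
  have Hn n := op_evens (op_not_pred1 (defn_const n)).
  apply: op_ext (op_and (op_or (Hn 0) HB) (op_or (Hn 1) HC)) => v X.
  by rewrite not_orE !not_andE.
- move=> [[t [C [EB xt]]] /IHB/op_odds HB].
  have : op (fun v X => forall n, n < tval v t ->
      ~ evens X =1 pred1 n \/ ~ witness (upd v x n) B (odds X)).
    apply: op_ball; first exact: defn_tval.
    apply: op_or; first exact: op_evens (op_not_pred1 (defn_var 0)).
    exact: op_upd HB.
  apply: op_ext => v X; split=> [H [n [En Hn]]|H n lt_n].
    have lt_n : n < tval v t.
      (* The first conjunct of [B] bounds [n] by [t], whose value is unaffected by updating [x]. *)
      move: Hn; rewrite EB /= => -[[]]; rewrite {1}/upd eqxx (@tval_fv t _ v) //.
      by move=> y yt; rewrite /upd; case: eqP => // Ey; rewrite -Ey yt in xt.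
    by case: (H n lt_n).
  by rewrite -not_andE => -[En Hn]; apply: H; exists n.
- move=> /IHB HB.
  have : op (fun v X => exists n, ~ witness (upd v x n) B (column X n)).
    apply: op_ex.
    apply: (op_subst HB (s := fun i v => upd (shift v) x (v 0) i)
                        (h := fun v k => cpair (v 0) k)).
      by move=> i; rewrite /upd; case: eqP => _; exact: defn_var.
    by apply: defn_cpair; exact: defn_var.
  by apply: op_ext => v X; rewrite -existsNE.
Qed.

(** * Definability of recursive witnesses *)

(** [G] enumerates output bits as in [app]; it has a value at [X] when exactly one bit appears at
    each position. *)
Definition graph (G : env -> real -> nat -> nat -> Prop) v X (Y : real) : Prop :=
  forall n (b : bool), Y n = b <-> G v X n b.

(* The functional with graph [G] sends every [X] outside [N] to a witness of
   [A], under the assignment [v \o r]; the further values of [v] are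
   parameters of [G] and [N]. *)
Definition realizes r A G (N : env -> real -> Prop) v : Prop :=
  forall X, ~ N v X -> exists Y, graph G v X Y /\ witness (v \o r) A Y.

Definition opG (G : env -> real -> nat -> nat -> Prop) : Prop :=
  op (fun v X => G (shift (shift v)) X (v 0) (v 1)).

Lemma opG_inst G (s : nat -> env -> nat) (h : env -> nat -> nat) f g :
  opG G -> (forall i, defn (s i)) -> defn (fun v => h (shift v) (v 0)) ->
  defn f -> defn g ->
  op (fun v X => G (s^~ v) (fun k => X (h v k)) (f v) (g v)).
Proof.
move=> HG Hs Hh Hf Hg.
pose s' i (v : env) := (f v .: g v .: s^~ v) i.
by apply: (op_subst HG (s := s') _ Hh) => -[|[|i]];
  [exact: Hf | exact: Hg | exact: Hs].
Qed.

Lemma opG_at G f g : opG G -> defn f -> defn g ->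
  op (fun v X => G v X (f v) (g v)).
Proof.
move=> HG; apply: (opG_inst (s := fun i v => v i) (h := fun _ k => k) HG).
  by move=> i; exact: defn_var.
exact: defn_var.
Qed.

Lemma opG_shift G f g : opG G -> defn f -> defn g ->
  op (fun v X => G (shift v) X (f v) (g v)).
Proof.
move=> HG; apply: (opG_inst (s := fun i v => shift v i) (h := fun _ k => k) HG).
  by move=> i; exact: defn_var.
exact: defn_var.
Qed.

Lemma op_shift Q : op Q -> op (fun v X => Q (shift v) X).
Proof.
by move=> HQ; apply: (op_env (s := fun i v => shift v i) HQ) => i; exact: defn_var.
Qed.

Definition total_on G (N : env -> real -> Prop) v : Prop :=
  forall X, ~ N v X -> exists Y, graph G v X Y.

Lemma orNP (P Q : Prop) : (P \/ Q) <-> (~ P -> Q).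
Proof.
split=> [[p np|//]|H]; first by case: np.
by case: (pselect P) => [|/H]; [left | right].
Qed.

(** That some bit appears is an open condition; that both do not is the negation of one. Hence both
    compactness lemmas are used. *)
Lemma def_total_on G N : opG G -> op N -> def (total_on G N).
Proof.
move=> HG HN.
have HGn b : op (fun v X => G (shift v) X (v 0) b).
  exact: opG_shift HG (defn_var 0) (defn_const b).
have : def (fun v =>
    (forall n X, N v X \/ (G v X n 0 \/ G v X n 1)) /\
    (forall n X, N v X \/ ~ (G v X n 0 /\ G v X n 1))).
  apply: def_and; apply: def_all.
    apply: def_forall_op; apply: op_or (op_shift HN) _; exact: op_or (HGn _) (HGn _).
  apply: def_forall_op_not (op_shift HN) _; exact: op_and (HGn _) (HGn _).
apply: def_ext => v; split=> [[Ht Hc] X nN|H].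
  exists (fun n => `[< G v X n 1 >]) => n [|]; split.
  - by move/asboolP.
  - by move=> Gn; apply/asboolP.
  - by move/negbT/asboolPn => nG; case: (Ht n X) => [|[]].
  - by move=> G0; apply/negbTE/asboolPn => G1; case: (Hc n X) => // -[].
split=> n X; apply/orNP => /H[Y HY].
  by case E : (Y n); move/HY: E; [right | left].
by move=> [/(HY n false) E0 /(HY n true)]; rewrite E0.
Qed.

(** The output must be constantly [0], and [P] is demanded only if some real lies outside [N]. *)
Lemma def_realizes_blank P G N : def P -> opG G -> op N ->
  def (fun v => forall X, ~ N v X ->
    exists Y, graph G v X Y /\ P v /\ Y =1 pred0).
Proof.
move=> HP HG HN.
have HGn b : op (fun v X => G (shift v) X (v 0) b).
  exact: opG_shift HG (defn_var 0) (defn_const b).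
have : def (fun v => (forall n X, N v X \/ G v X n 0) /\
    (forall n X, N v X \/ ~ G v X n 1) /\ ((forall X, N v X) \/ P v)).
  apply: def_and.
    apply: def_all; apply: def_forall_op; exact: op_or (op_shift HN) (HGn _).
  apply: def_and; last by apply: def_or => //; exact: def_forall_op.
  apply: def_all; exact: def_forall_op_not (op_shift HN) (HGn _).
apply: def_ext => v; split=> [[H0 [H1 HNP]] X nN|H].
  exists pred0; split; last by case: HNP.
  move=> n [|]; split=> //=; first by case: (H1 n X).
  by case: (H0 n X).
split=> [n X|].
  by apply/orNP => /H[Y [HY [_ Y0]]]; apply/(HY n false); exact: Y0.
split=> [n X|].
  by apply/orNP => /H[Y [HY [_ Y0]]] /(HY n true); rewrite Y0.
by apply/orNP => /existsNP[X /H[Y [_ []]]].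
Qed.

Definition singleton_on G (N : env -> real -> Prop) v : Prop :=
  forall X, ~ N v X -> exists n, graph G v X (pred1 n).

(** Having an element is open, and so is having two given distinct ones; the latter is excluded pair
    by pair. *)
Lemma def_singleton_on G N : opG G -> op N -> def (singleton_on G N).
Proof.
move=> HG HN.
have : def (fun v => total_on G N v /\
    (forall X, N v X \/ exists n, G v X n 1) /\
    (forall n m, ~ n = m -> forall X, N v X \/ ~ (G v X n 1 /\ G v X m 1))).
  apply: def_and; first exact: def_total_on.
  apply: def_and.
    apply: def_forall_op; apply: op_or => //; apply: op_ex.
    exact: opG_shift HG (defn_var 0) (defn_const 1).
  apply: def_all; apply: def_all; apply: def_imp; first by def_auto.
  apply: (@def_forall_op_not (fun v X => N (shift (shift v)) X)).
    exact: op_shift (op_shift HN).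
  apply: op_and.
    apply: (op_shift (Q := fun v X => G (shift v) X (v 0) 1)).
    exact: opG_shift HG (defn_var 0) (defn_const 1).
  apply: (opG_inst (s := fun i v => v i.+2) (h := fun _ k => k) HG);
    [move=> i|..]; by [exact: defn_var | exact: defn_const].
apply: def_ext => v; split=> [[Ht [He Hu]] X nN|H].
  have [Y HY] := Ht X nN; have [//|[n Gn]] := He X; exists n.
  suff -> : pred1 n = Y :> real by [].
  apply: funext => m /=; case: eqP => [->|ne]; first exact/esym/(HY n true).
  apply/esym/negbTE/negP => /(HY m true) Gm.
  by have [//|[]] := Hu m n ne X.
split=> [X /H[n Hn]|]; first by exists (pred1 n).
split=> [X|n m ne X].
  by apply/orNP => /H[n Hn]; exists n; apply/(Hn n true) => /=; rewrite eqxx.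
apply/orNP => /H[k Hk] [/(Hk n true) /eqP En /(Hk m true) /eqP Em].
by apply: ne; rewrite En Em.
Qed.

Definition evensG (G : env -> real -> nat -> nat -> Prop) :=
  fun v X n b => G v X n.*2 b.
Definition oddsG (G : env -> real -> nat -> nat -> Prop) :=
  fun v X n b => G v X n.*2.+1 b.

Lemma opG_evens G : opG G -> opG (evensG G).
Proof.
move=> HG; apply: (opG_inst (s := fun i v => v i.+2) (h := fun _ k => k) HG);
  [move=> i|..]; try exact: defn_var; exact: defn_double (defn_var 0).
Qed.

Lemma opG_odds G : opG G -> opG (oddsG G).
Proof.
move=> HG; apply: (opG_inst (s := fun i v => v i.+2) (h := fun _ k => k) HG);
  [move=> i|..]; try exact: defn_var.
exact: defn_succ (defn_double (defn_var 0)).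
Qed.

Lemma graph_evens G v X Y : graph G v X Y -> graph (evensG G) v X (evens Y).
Proof. by move=> H n b; exact: H. Qed.

Lemma graph_odds G v X Y : graph G v X Y -> graph (oddsG G) v X (odds Y).
Proof. by move=> H n b; exact: H. Qed.

Lemma graph_join G v X Y Z :
  graph (evensG G) v X Y -> graph (oddsG G) v X Z -> graph G v X (join Y Z).
Proof.
move=> HY HZ n b; rewrite -[in G v X n](odd_double_half n) /join.
by case: odd; [exact: HZ | exact: HY].
Qed.

Fixpoint restricted (A : form) : Prop :=
  match A with
  | FEq _ _ | FLt _ _ => True
  | FNot B => box_free B
  | FAnd B C | FOr B C => restricted B /\ restricted C
  | FImp B C => fan_form B /\ restricted C
  | FEx _ B | FAll _ B => restricted B
  | FBox _ => False
  end.

Definition rbind (r : nat -> nat) (x : nat) : nat -> nat :=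
  fun i => if i == x then 0 else (r i).+1.

Lemma rbind_upd r x n v : (n .: v) \o rbind r x = upd (v \o r) x n.
Proof. by apply: funext => i; rewrite /rbind /upd /=; case: eqP. Qed.

(** [r], [G] and [N] stay general in the induction, since each compound formula passes a new
    functional or a new domain to its parts. *)
Lemma def_realizes A : restricted A -> forall r G N, opG G -> op N ->
  def (realizes r A G N).
Proof.
elim: A => //= [s t _|s t _|B _ bB|B IHB C IHC|B IHB C IHC|B _ C IHC|x B IHB|x B IHB]
  => [r G N HG HN|r G N HG HN|r G N HG HN|[bB bC] r G N HG HN|[bB bC] r G N HG HN
     |[bB bC] r G N HG HN|bB r G N HG HN|bB r G N HG HN].
- apply: def_realizes_blank => //; exact: def_ren (def_teq s t) r.
- apply: def_realizes_blank => //.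
  apply: (def_ren (P := fun v => tval v s < tval v t)).
  by apply: def_leq; [apply: defn_succ|]; exact: defn_tval.
- apply: def_realizes_blank => //.
  apply: (def_ren (P := fun v => ~ exists Y, witness v B Y)).
  by apply: def_ext (def_not (def_csat bB)) => v; rewrite csat_witness.
- apply: def_ext (def_and (IHB bB r _ _ (opG_evens HG) HN)
                          (IHC bC r _ _ (opG_odds HG) HN)) => v.
  split=> [[HB HC] X nN|H].
    have [Y [GY WY]] := HB X nN; have [Z [GZ WZ]] := HC X nN.
    exists (join Y Z); split; first exact: graph_join.
    by rewrite /= evens_join odds_join.
  split=> X /H[Y [GY [WB WC]]].
    by exists (evens Y); split=> //; exact: graph_evens.
  by exists (odds Y); split=> //; exact: graph_odds.
- have HGn n b : op (fun v X => G v X n b).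
    exact: opG_at HG (defn_const n) (defn_const b).
  (* Positions [0] and [2] tell whether the tag contains [0] or [1]. Adding to [N] the open set
     where that bit is [0] leaves the piece on which the disjunct was chosen. *)
  have : def (fun v => singleton_on (evensG G) N v /\
      (forall X, N v X \/ (G v X 0 1 \/ G v X 2 1)) /\
      realizes r B (oddsG G) (fun v X => N v X \/ G v X 0 0) v /\
      realizes r C (oddsG G) (fun v X => N v X \/ G v X 2 0) v).
    apply: def_and; first by apply: def_singleton_on HN; exact: opG_evens.
    apply: def_and.
      by apply: def_forall_op; apply: op_or => //; exact: op_or.
    by apply: def_and; [apply: IHB | apply: IHC]; rewrite //;
      by [exact: opG_odds | exact: op_or].
  apply: def_ext => v; split=> [[Hs [H01 [HB HC]]] X nN|H].
    have [n Gn] := Hs X nN; have [//|[G0|G2]] := H01 X.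
      have /eqP En : 0 == n by exact/(Gn 0 true).
      have [|Z [GZ WZ]] := HB X; first by case=> // /(Gn 0 false); rewrite -En.
      exists (join (pred1 n) Z); split; first exact: graph_join.
      by left; rewrite evens_join odds_join -En.
    have /eqP En : 1 == n by exact/(Gn 1 true).
    have [|Z [GZ WZ]] := HC X; first by case=> // /(Gn 1 false); rewrite -En.
    exists (join (pred1 n) Z); split; first exact: graph_join.
    by right; rewrite evens_join odds_join -En.
  split=> [X /H[Y [GY WY]]|].
    by case: WY => -[/funext EY _]; [exists 0 | exists 1]; rewrite -EY;
      exact: graph_evens.
  split=> [X|].
    apply/orNP => /H[Y [GY WY]].
    by case: WY => -[EY _]; [left; apply/(GY 0 true) | right; apply/(GY 2 true)];
      [exact: (EY 0) | exact: (EY 1)].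
  split=> X /not_orP[/H[Y [GY WY]] nG]; exists (odds Y);
    (split; first exact: graph_odds); case: WY => -[EY //];
    case: nG; [apply/(GY 0 false); exact: (EY 0) | apply/(GY 2 false); exact: (EY 1)].
(* Uncurrying: [G'] takes the join of [X] with a witness of the antecedent and applies the output of
   [G] at [X] to that witness. *)
- pose G' v X n b :=
    exists k, G v (evens X) (cpair (segment (odds X) k) (cpair n b)) 1.
  pose N' v X := N v (evens X) \/ ~ witness (v \o r) B (odds X).
  have HG' : opG G'.
    (* Naming the segment [s] separates the queries to the two halves of [X]. *)
    have : op (fun v X => exists k s, s = segment (odds X) k /\
        G (shift (shift v)) (evens X) (cpair s (cpair (v 0) (v 1))) 1).
      apply: op_ex; apply: op_ex; apply: op_and.
        apply: (op_odds (Q := fun v X => v 0 = segment X (v 1))).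
        by apply: op_segment; exact: defn_var.
      apply: (opG_inst (s := fun i v => v i.+4) (h := fun _ => double) HG).
      - by move=> i; exact: defn_var.
      - exact: defn_double (defn_var 0).
      - by rewrite /shift; do 2 (apply: defn_cpair; first exact: defn_var);
          exact: defn_var.
      - exact: defn_const.
    apply: op_ext => v X; split=> [[k [s [-> Gs]]]|[k Gk]]; first by exists k.
    by exists k, (segment (odds X) k).
  have HN' : op N'.
    apply: op_or; first exact: op_evens.
    apply: (op_odds (Q := fun v X => ~ witness (v \o r) B X)).
    apply: (op_env (s := fun i v => v (r i)) (op_not_witness bB)) => i.
    exact: defn_var.
  apply: def_ext (def_and (def_total_on HG HN) (IHC bC r _ _ HG' HN')) => v.
  have appE X W : graph G v X W -> forall Y Z,
      app W Y Z <-> graph G' v (join X Y) Z.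
    move=> GW Y Z; split=> HZ n b; rewrite /G' ?evens_join ?odds_join HZ;
      rewrite /G' ?evens_join ?odds_join;
      by split=> -[k /(GW _ true) Wk]; exists k.
  split=> [[Ht HC] X nN|H].
    have [W GW] := Ht X nN; exists W; split=> // Y WY.
    have [|Z [GZ WZ]] := HC (join X Y).
      by rewrite /N' evens_join odds_join => -[].
    by exists Z; split=> //; apply/(appE _ _ GW).
  split=> [X /H[W [GW _]]|X]; first by exists W.
  move=> /not_orP[/H[W [GW HW]] /contrapT/HW[Z [aZ WZ]]].
  exists Z; split=> //; rewrite -(join_evens_odds X); exact/(appE _ _ GW).
(* The chosen number becomes a parameter at position [0]; [N'] removes the reals at which the tag
   lacks it. *)
- pose G' v X n b := oddsG G (shift v) X n b.
  pose N' v X := N (shift v) X \/ G (shift v) X (v 0).*2 0.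
  have : def (fun v => singleton_on (evensG G) N v /\
      forall n, realizes (rbind r x) B G' N' (n .: v)).
    apply: def_and; first by apply: def_singleton_on HN; exact: opG_evens.
    apply: def_all.
    have -> : (fun v => realizes (rbind r x) B G' N' (v 0 .: shift v)) =
              realizes (rbind r x) B G' N'.
      by apply: funext => v; congr realizes; apply: funext => -[].
    apply: IHB => //.
      apply: (opG_inst (s := fun i v => v i.+3) (h := fun _ k => k) HG);
        [move=> i|..]; try exact: defn_var.
      exact: defn_succ (defn_double (defn_var 0)).
    apply: op_or (op_shift HN) _; apply: opG_shift HG _ (defn_const 0).
    exact: defn_double (defn_var 0).
  apply: def_ext => v; split=> [[Hs HB] X nN|H].
    have [n Gn] := Hs X nN; have [|Z [GZ WZ]] := HB n X.
      by case=> // /(Gn n false) /=; rewrite eqxx.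
    exists (join (pred1 n) Z); split; first exact: graph_join.
    by exists n; rewrite evens_join odds_join -rbind_upd.
  split=> [X /H[Y [GY [n [/funext En _]]]]|n X /not_orP[/H[Y [GY [m [Em WY]]]] nG]].
    by exists n; rewrite -En; exact: graph_evens.
  have Enm : m = n.
    apply/eqP; rewrite eq_sym; apply: contra_notT nG => ne.
    by apply/(GY n.*2 false); have := Em n; rewrite /evens /= => ->; exact: negbTE.
  exists (odds Y); rewrite rbind_upd -Enm; split=> //.
  exact: (graph_odds GY).
(* Here [G'] computes the column numbered by the new parameter. *)
- pose G' v X n b := G (shift v) X (cpair (v 0) n) b.
  pose N' v X := N (shift v) X.
  have : def (fun v => forall n, realizes (rbind r x) B G' N' (n .: v)).
    apply: def_all.
    have -> : (fun v => realizes (rbind r x) B G' N' (v 0 .: shift v)) =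
              realizes (rbind r x) B G' N'.
      by apply: funext => v; congr realizes; apply: funext => -[].
    apply: IHB => //; last exact: op_shift.
    apply: (opG_inst (s := fun i v => v i.+3) (h := fun _ k => k) HG);
      [move=> i|..]; try exact: defn_var.
    by apply: defn_cpair; exact: defn_var.
  apply: def_ext => v; split=> [H X nN|H n X /H[Y [GY WY]]].
    have /choice[F HF] : forall n, exists Y,
        graph G' (n .: v) X Y /\ witness (upd (v \o r) x n) B Y.
      by move=> n; rewrite -rbind_upd; exact: (H n X nN).
    exists (columns F); split=> [p b|n]; last by rewrite column_columns; case: (HF n).
    by rewrite -[in G _ _ p](cpairK p); exact: (proj1 (HF (pfst p))).
  by exists (column Y n); rewrite rbind_upd; split=> // k b; exact: GY.
Qed.

Lemma restricted_form A : box_free A ->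
  (forall B C, subformula (FImp B C) A -> imp_free B /\ no_unbounded_ex B) ->
  restricted A.
Proof.
elim: A => //= [B IHB C IHC|B IHB C IHC|B _ C IHC|x B IHB|x B IHB].
- by move=> [bB bC] H; split; [apply: IHB | apply: IHC] => // D E HD;
    apply: (H D E); right; [left | right].
- by move=> [bB bC] H; split; [apply: IHB | apply: IHC] => // D E HD;
    apply: (H D E); right; [left | right].
- move=> [bB bC] H; split.
    by have [|Hi Hx] := H B C; [left | exact: antecedent_fan_form].
  by apply: IHC => // D E HD; apply: (H D E); do 2 right.
- by move=> bB H; apply: IHB => // D E HD; apply: (H D E); right.
- by move=> bB H; apply: IHB => // D E HD; apply: (H D E); right.
Qed.

Definition codes_witness (phi : form) (e : nat) (v : env) : Prop :=
  exists c Y, [/\ e = encode c, computes c Y & witness v phi Y].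

(** The functional ignores its input and outputs what code [e] computes; with [N] empty, it realizes
    [phi] iff [e] computes a witness. Position [0] holds [e], hence the renaming [succn]. *)
Lemma def_codes_witness phi : restricted phi ->
  def (fun v => codes_witness phi (v 0) (shift v)).
Proof.
move=> Rphi.
have HG : opG (fun v _ n b => evalc (v 0) n b).
  by apply: op_def; apply: def_evalc; exact: defn_var.
have HN : op (fun _ _ => False).
  apply: op_def; apply: def_ext (def_leq (defn_const 1) (defn_const 0)) => v.
  by split.
apply: def_ext (def_realizes Rphi succn HG HN) => v; split=> [H|].
  have [//|Y [GY WY]] := H pred0; have [c Ec] := encode_surj (v 0).
  exists c, Y; split=> // n; apply/evalcE; rewrite Ec; exact/(GY n (Y n)).
move=> [c [Y [Ec cY WY]]] X _; exists Y; split=> // n b; rewrite Ec evalcE.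
split=> [<-//|H]; apply/eq_real_nat; exact: eval_inj (cY n) H.
Qed.

(** * Free variables and the defining formula *)

Lemma witness_fv A v v' X :
  {in fv A, v =1 v'} -> witness v A X -> witness v' A X.
Proof.
have upd_in x (B : form) n (u u' : env) :
    {in [seq y <- fv B | y != x], u =1 u'} ->
    {in fv B, upd u x n =1 upd u' x n}.
  move=> H y yB; rewrite /upd; case: eqP => // /eqP ne; apply: H.
  by rewrite mem_filter ne.
have cat (B C : form) (u u' : env) : {in fv B ++ fv C, u =1 u'} ->
    {in fv B, u =1 u'} /\ {in fv C, u =1 u'}.
  by move=> H; split=> y yB; apply: H; rewrite mem_cat yB ?orbT.
have sym (s : seq nat) (u u' : env) : {in s, u =1 u'} -> {in s, u' =1 u}.
  by move=> H y ys; rewrite H.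
have tcat s t (u u' : env) : {in tfv s ++ tfv t, u =1 u'} ->
    tval u s = tval u' s /\ tval u t = tval u' t.
  by move=> H; split; apply: tval_fv => y ys; apply: H; rewrite mem_cat ys ?orbT.
elim: A v v' X => /= [s t|s t|B IHB|B IHB C IHC|B IHB C IHC|B IHB C IHC|x B IHB
  |x B IHB|B IHB] v v' X.
- by move=> /tcat[-> ->].
- by move=> /tcat[-> ->].
- move=> /sym H [nB X0]; split=> // -[Y /(IHB _ _ _ H) HY].
  by apply: nB; exists Y.
- by move=> /cat[HB HC] [/(IHB _ _ _ HB) ? /(IHC _ _ _ HC) ?].
- move=> /cat[HB HC] [[EX /(IHB _ _ _ HB) ?]|[EX /(IHC _ _ _ HC) ?]].
    by left.
  by right.
- move=> /cat[/sym HB HC] H Y /(IHB _ _ _ HB)/H[Z [aZ /(IHC _ _ _ HC) HZ]].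
  by exists Z.
- move=> /(upd_in x B)-H [n [En /(IHB _ _ _ (H n)) Hn]].
  by exists n.
- by move=> /(upd_in x B)-H HX n; apply: IHB (HX n); exact: H.
- by move=> H [c [Y [EX cY /(IHB _ _ _ H) HY]]]; exists c, Y.
Qed.

Lemma codes_witness_fv phi e v v' :
  {in fv phi, v =1 v'} -> codes_witness phi e v -> codes_witness phi e v'.
Proof.
by move=> H [c [Y [Ee cY /(witness_fv H) WY]]]; exists c, Y.
Qed.

Lemma fv_foldr_ex A s x : (x \in fv (foldr FEx A s)) = (x \in fv A) && (x \notin s).
Proof.
elim: s => /= [|y s IH]; first by rewrite andbT.
by rewrite mem_filter IH in_cons negb_or andbCA.
Qed.

Lemma box_free_foldr_ex A s : box_free A -> box_free (foldr FEx A s).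
Proof. by elim: s. Qed.

Lemma csat_foldr_ex A s :
  (forall y v n, y \in s -> csat (upd v y n) A <-> csat v A) ->
  forall v, csat v (foldr FEx A s) <-> csat v A.
Proof.
elim: s => //= y s IH H v.
have Hs v' : csat v' (foldr FEx A s) <-> csat v' A.
  by apply: IH => y' u n y's; apply: H; rewrite in_cons y's orbT.
have Hy n : csat (upd v y n) A <-> csat v A by apply: H; exact: mem_head.
by split=> [[n /Hs/Hy]//|Hv]; exists 0; apply/Hs/Hy.
Qed.

(** The formula given by [def_formula] may have stray free variables; its truth does not depend on
    them, so vacuous existential quantifiers bind them. *)
Lemma codes_witness_formula phi z : restricted phi -> z \notin fv phi ->
  exists theta, [/\ box_free theta, {subset fv theta <= z :: fv phi} &
    forall v, csat v theta <-> codes_witness phi (v z) v].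
Proof.
move=> Rphi zphi.
have [_ [_ H]] := def_formula (def_codes_witness Rphi).
have [A [bA EA]] := H (fun i => if i is i'.+1 then i' else z).
have {}EA v : csat v A <-> codes_witness phi (v z) v by exact: EA.
pose s := [seq y <- fv A | y \notin z :: fv phi].
exists (foldr FEx A s); split.
- exact: box_free_foldr_ex.
- move=> x; rewrite fv_foldr_ex mem_filter negb_and negbK => /andP[xA].
  by rewrite xA orbF.
- move=> v; rewrite csat_foldr_ex // => y u n.
  rewrite mem_filter in_cons negb_or => /andP[/andP[yz yphi] _].
  rewrite !EA {1}/upd eq_sym (negbTE yz).
  by split; apply: codes_witness_fv => x xphi; rewrite /upd;
    case: eqP => // Ex; rewrite -Ex xphi in yphi.
Qed.

Lemma witness_not_not v A X : box_free A ->
  witness v (FNot (FNot A)) X <-> csat v A /\ X =1 pred0.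
Proof.
move=> bA /=; rewrite csat_witness //.
by rewrite blank_realizer not_notE.
Qed.

(** A witness that serves all assignments yields one of the closure by repetition in every
    column. *)
Lemma constructively_valid_uniform A W : recursive W ->
  (forall v, witness v A W) -> constructively_valid A.
Proof.
move=> rW HW; rewrite /constructively_valid /constructively_true.
suff [X [rX HX]] : exists X, recursive X /\
    forall v, witness v (universal_closure A) X by exists X.
rewrite /universal_closure; elim: (undup _) => [|x s [X [rX HX]]] /=.
  by exists W.
exists (columns (fun=> X)); split; first exact: recursive_columns.
by move=> v n; rewrite column_columns.
Qed.

Theorem theorem5 (phi : form)
  (phi_arith : arithmetical phi)
  (phi_imp : forall A B : form, subformula (FImp A B) phi ->
     imp_free A /\ no_unbounded_ex A) :
  exists psi : form,
    [/\ arithmetical psi,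
        {subset fv psi <= fv phi} &
        constructively_valid (FIff (FBox phi) psi)].
Proof.
have Rphi := restricted_form (arithmetical_box_free phi_arith) phi_imp.
pose z := (\max_(x <- fv phi) x).+1.
have zphi : z \notin fv phi.
  apply/negP => zphi; have := @leq_bigmax_seq _ (fv phi) xpredT id z zphi isT.
  by rewrite ltnn.
have [theta [btheta fvtheta Etheta]] := codes_witness_formula Rphi zphi.
have Eupd v e : csat (upd v z e) theta <-> codes_witness phi e v.
  rewrite Etheta {1}/upd eqxx; split; apply: codes_witness_fv => x xphi;
    by rewrite /upd; case: eqP => // Ex; rewrite -Ex xphi in zphi.
exists (FEx z (FNot (FNot theta))); split.
- exact: box_free_arithmetical.
- move=> x; rewrite mem_filter => /andP[xz /fvtheta].
  by rewrite in_cons (negbTE xz).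
apply: (@constructively_valid_uniform _ (join add_blank drop_blank)).
  exact: recursive_join add_blank_recursive drop_blank_recursive.
move=> v; split; rewrite ?evens_join ?odds_join => Y.
  move=> [c [X [/funext-> cX WX]]]; exists (join (pred1 (encode c)) pred0).
  split; first exact: add_blank_app.
  exists (encode c); rewrite evens_join odds_join; split=> //.
  by apply/witness_not_not => //; split=> //; apply/Eupd; exists c, X.
(* The second half of [Y] is blank, so [Y] is exactly the join on which [drop_blank] is known to
   act. *)
move=> [e [/funext Ee /(witness_not_not _ _ btheta)[/Eupd[c [X [Ec cX WX]]] /funext Y0]]].
exists (pred1 e); split; last by exists c, X; rewrite -Ec.
by rewrite -(join_evens_odds Y) Ee Y0; exact: drop_blank_app.
Qed.
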